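(* Let $n\ge 2$ and let $(M,g)$ be an $n$-dimensional complete Riemannian manifold (without boundary). If the local Moser-Trudinger inequality (LMT) holds on $W_0^{1,n}(M)$, then the Ruf-Moser-Trudinger inequality holds on $W_0^{1,n}(M)$: for any $\kappa>0$ there is a constant $C>0$ such that $$\int_M \exp_{n-2}\big[\gamma_n|u|^{\frac{n}{n-1}}\big]\,d\mu\le C\qquad\text{for all } u\in W_0^{1,n}(M)\text{ with } \|\nabla u\|_n^n+\kappa\|u\|_n^n\le 1.$$
   Context: $\mu$ is the Riemannian measure of $(M,g)$; $\nabla u$ is the Riemannian gradient, $|\nabla u|^2=g(\nabla u,\nabla u)$, and $\|\cdot\|_n$ is the $L^n$ norm with respect to $\mu$. $W^{1,n}(M)$ is the usual Sobolev space, which on a complete manifold coincides with $W^{1,n}_0(M)$, the closure of $C_c^\infty(M)$. The constant is $\gamma_n=n\,\omega_{n-1}^{\frac{1}{n-1}}$, where $\omega_{n-1}$ is the surface measure of the standard unit sphere $S^{n-1}\subset\mathbb{R}^n$. For an integer $m\ge 0$, $\exp_m[t]=e^t-\sum_{k=0}^m \frac{t^k}{k!}$. (LMT): the local Moser-Trudinger inequality holds on $W^{1,n}(M)=W_0^{1,n}(M)$ if there are constants $\tau,C_0>0$ such that for every bounded measurable set $E\subseteq M$ with $\mu(E)\le\tau$, $$\int_E e^{\gamma_n|u|^{\frac{n}{n-1}}}\,d\mu\le C_0\qquad\text{for all } u\in W^{1,n}(M)\text{ with } \|\nabla u\|_n\le 1,\ \operatorname{supp}u\subseteq E,$$ where $\operatorname{supp}u$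 is the essential support, i.e. $\operatorname{supp}u\subseteq E$ means $u=0$ a.e. on $M\setminus E$. *)

(* Defs.v *)
(* MathComp-Analysis, over an arbitrary R : realType. *)
From mathcomp Require Import all_boot all_order all_algebra.
From mathcomp Require Import all_classical all_reals all_analysis.

Set Implicit Arguments.
Unset Strict Implicit.
Unset Printing Implicit Defensive.

Import Order.TTheory GRing.Theory Num.Theory.
Import numFieldNormedType.Exports.

Local Open Scope classical_set_scope.
Local Open Scope ring_scope.

(* Partial derivatives are only meaningful on U, which is open in every use. *)
Fixpoint Ck_on (R : realType) (n k : nat) (U : set 'rV[R]_n)
    (f : 'rV[R]_n -> R) : Prop :=
  {in U, continuous f} /\
  match k with
  | 0 => True
  | k'.+1 => forall i : 'I_n,
      (forall x, U x -> derivable f x (delta_mx 0 i)) /\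
      Ck_on k' U ('D_(delta_mx 0 i) f)
  end.

Definition smooth_on (R : realType) (n : nat) (U : set 'rV[R]_n)
    (f : 'rV[R]_n -> R) : Prop := forall k, Ck_on k U f.

(* Integral over R^n of a nonnegative Borel function, by iterated
   one-dimensional Lebesgue integrals (Tonelli). *)
Fixpoint leb_int (R : realType) (n : nat) :
    ('rV[R]_n -> \bar R) -> \bar R :=
  match n with
  | 0 => fun f => f 0
  | m.+1 => fun f =>
      (\int[lebesgue_measure]_(t in [set: R])
         leb_int (fun y : 'rV[R]_m => f (row_mx t%:M y : 'rV[R]_(1 + m))))%E
  end.

Definition leb_vol (R : realType) (n : nat) (A : set 'rV[R]_n) : \bar R :=
  leb_int (fun x => (\1_A x)%:E).

Definition unit_sphere (R : realType) (n : nat) : set 'rV[R]_n :=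
  [set x | \sum_(i < n) x 0 i ^+ 2 = 1].

(* The surface measure sigma on the unit sphere of R^n, normalized by the polar
   decomposition dx = r^(n-1) dr dsigma: the cone over A has volume sigma(A)/n. *)
Definition surface_measure (R : realType) (n : nat) (A : set 'rV[R]_n) : \bar R :=
  (n%:R%:E *
   leb_vol [set t *: x | t in [set t : R | (0 < t <= 1)%R] & x in A])%E.

Definition omega (R : realType) (n : nat) : R :=
  fine (surface_measure (@unit_sphere R n)).

Definition MTconst (R : realType) (n : nat) : R :=
  n%:R * omega R n `^ (n.-1%:R)^-1.

(* exp_m[t] = e^t - sum_(k = 0..m) t^k / k! *)
Definition exp_trunc (R : realType) (m : nat) (t : R) : R :=
  expR t - \sum_(0 <= k < m.+1) t ^+ k / k`!%:R.

(* cinv is only meaningful on the open image of the chart. *)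
Record chart (R : realType) (n : nat) (M : topologicalType) := Chart {
  cdom : set M ;
  cfun : M -> 'rV[R]_n ;
  cinv : 'rV[R]_n -> M ;
  cdom_open : open cdom ;
  cimg_open : open (cfun @` cdom) ;
  cfunK : {in cdom, cancel cfun cinv} ;
  cfun_continuous : {in cdom, continuous cfun} ;
  cinv_continuous : {in cfun @` cdom, continuous cinv} }.

Definition cimg (R : realType) (n : nat) (M : topologicalType)
  (c : chart R n M) : set 'rV[R]_n := cfun c @` cdom c.

(* The atlas need not be maximal. The tangent space at p is 'rV[R]_n, through
   the coordinates of the distinguished chart chart_at p. *)
Record smooth_manifold (R : realType) (n : nat) (M : topologicalType) := Manifold {
  atlas : set (chart R n M) ;
  chart_at : M -> chart R n M ;
  chart_at_atlas : forall p, atlas (chart_at p) ;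
  chart_at_dom : forall p, cdom (chart_at p) p ;
  transition_smooth : forall c c', atlas c -> atlas c' -> forall i : 'I_n,
    smooth_on (cfun c @` (cdom c `&` cdom c'))
              (fun x => (cfun c' (cinv c x)) 0 i) ;
  manifold_hausdorff : hausdorff_space M ;
  manifold_second_countable : @second_countable M }.

(* Matrix of the change of coordinates from c to c' at p; coordinates being row
   vectors, v (components in c) becomes v *m coord_change c c' p. *)
Definition coord_change (R : realType) (n : nat) (M : topologicalType)
    (c c' : chart R n M) (p : M) : 'M[R]_n :=
  'J (cfun c' \o cinv c) (cfun c p).

Definition smooth_fun (R : realType) (n : nat) (M : topologicalType)
    (S : smooth_manifold R n M) (u : M -> R) : Prop :=
  forall c, atlas S c -> smooth_on (cimg c) (u \o cinv c).

(* Components in the chart c of a bilinear form b on the tangent space at p. *)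
Definition form_in_chart (R : realType) (n : nat) (M : topologicalType)
    (S : smooth_manifold R n M) (b : M -> 'M[R]_n) (c : chart R n M) (p : M) :
    'M[R]_n :=
  let A := coord_change c (chart_at S p) p in A *m b p *m A^T.

Record riemannian_metric (R : realType) (n : nat) (M : topologicalType)
    (S : smooth_manifold R n M) := RiemannianMetric {
  metric : M -> 'M[R]_n ;
  metric_sym : forall p, (metric p)^T = metric p ;
  metric_pos : forall p (v : 'rV[R]_n),
    v != 0 -> 0 < (v *m metric p *m v^T) 0 0 ;
  metric_smooth : forall c, atlas S c -> forall i j : 'I_n,
    smooth_on (cimg c) (fun x => form_in_chart S metric c (cinv c x) i j) }.

Section riemannian.
Context (R : realType) (n : nat) (M : topologicalType)
        (S : smooth_manifold R n M) (g : riemannian_metric S).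

Definition gnorm (p : M) (v : 'rV[R]_n) : R :=
  Num.sqrt ((v *m metric g p *m v^T) 0 0).

Definition differential (u : M -> R) (p : M) : 'rV[R]_n :=
  \row_(i < n)
    'D_(delta_mx 0 i) (u \o cinv (chart_at S p)) (cfun (chart_at S p) p).

Definition gradient (u : M -> R) (p : M) : 'rV[R]_n :=
  differential u p *m invmx (metric g p).

Definition C1_curve (y : R -> M) : Prop :=
  continuous y /\
  forall c, atlas S c -> forall t, cdom c (y t) ->
    derivable (cfun c \o y) t 1 /\ {for t, continuous (derive1 (cfun c \o y))}.

Definition velocity (y : R -> M) (t : R) : 'rV[R]_n :=
  derive1 (cfun (chart_at S (y t)) \o y) t.

Definition curve_length (y : R -> M) : \bar R :=
  (\int[lebesgue_measure]_(t in `[0%R, 1%R]) (gnorm (y t) (velocity y t))%:E)%E.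

(* l is the length of a piecewise C^1 curve from p to q, each C^1 piece being
   parametrized by [0, 1]. *)
Inductive path_length : M -> M -> \bar R -> Prop :=
| path_nil p : path_length p p 0%E
| path_cons (y : R -> M) q l : C1_curve y -> path_length (y 1) q l ->
    path_length (y 0) q (curve_length y + l)%E.

Definition rdist (p q : M) : \bar R := ereal_inf [set l | path_length p q l].

Definition complete_metric : Prop :=
  forall x : nat -> M,
    (forall e : R, 0 < e -> exists N : nat, forall i j : nat,
       (N <= i)%N -> (N <= j)%N -> (rdist (x i) (x j) < e%:E)%E) ->
    exists p, rdist (x i) p @[i --> \oo] --> 0%E.

Definition rbounded (E : set M) : Prop :=
  exists r : R, forall p q, E p -> E q -> (rdist p q <= r%:E)%E.

End riemannian.

Notation borelType M := (g_sigma_algebraType (@open M)).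

Section sobolev.
Context (R : realType) (n : nat) (M : ptopologicalType)
        (S : smooth_manifold R n M) (g : riemannian_metric S)
        (mu : {measure set (borelType M) -> \bar R}).

(* d mu = sqrt(det g) dx in every chart. *)
Definition is_riemannian_measure : Prop :=
  forall c, atlas S c -> forall A : set (borelType M),
    measurable A -> A `<=` cdom c ->
    mu A = leb_int (fun x : 'rV[R]_n =>
      (\1_(cfun c @` A) x *
       Num.sqrt (\det (form_in_chart S (metric g) c (cinv c x))))%:E).

Definition test_function (u : M -> R) : Prop :=
  smooth_fun S u /\ compact (closure [set p | u p != 0]).

Definition measurable_field (X : M -> 'rV[R]_n) : Prop :=
  forall c, atlas S c -> forall i : 'I_n,
    measurable_fun (cdom c : set (borelType M))
      (fun p : borelType M => (X p *m coord_change (chart_at S p) c p) 0 i).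

Definition fun_norm (u : M -> R) : \bar R :=
  Lnorm mu n%:R%:E (fun p : borelType M => (u p)%:E).

Definition field_norm (X : M -> 'rV[R]_n) : \bar R :=
  Lnorm mu n%:R%:E (fun p : borelType M => (gnorm g p (X p))%:E).

(* u is in W_0^{1,n}(M) and X is its (a.e. unique) gradient: (u, X) is in the
   closure of {(f, grad f) | f in C_c^oo(M)} for the W^{1,n} norm. *)
Definition W0 (u : M -> R) (X : M -> 'rV[R]_n) : Prop :=
  [/\ measurable_fun [set: borelType M] (u : borelType M -> R),
      measurable_field X &
      exists f : nat -> M -> R,
        [/\ forall k, test_function (f k),
            fun_norm (fun p => f k p - u p) @[k --> \oo] --> 0%E &
            field_norm (fun p => gradient g (f k) p - X p) @[k --> \oo] --> 0%E]].

Definition local_MoserTrudinger : Prop :=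
  exists tau C0 : R, [/\ 0 < tau, 0 < C0 &
    forall E : set (borelType M),
      measurable E -> rbounded g E -> (mu E <= tau%:E)%E ->
      forall (u : M -> R) (X : M -> 'rV[R]_n),
        W0 u X -> (field_norm X <= 1)%E ->
        {ae mu, forall p, ~ E p -> u p = 0} ->
        (\int[mu]_(p in E)
           (expR (MTconst R n * `|u p| `^ (n%:R / n.-1%:R)))%:E <= C0%:E)%E].

Definition Ruf_MoserTrudinger : Prop :=
  forall kappa : R, 0 < kappa ->
    exists2 C : R, 0 < C &
      forall (u : M -> R) (X : M -> 'rV[R]_n),
        W0 u X -> (field_norm X ^+ n + kappa%:E * fun_norm u ^+ n <= 1)%E ->
        (\int[mu]_(p in [set: M])
           (exp_trunc (n - 2) (MTconst R n * `|u p| `^ (n%:R / n.-1%:R)))%:E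
         <= C%:E)%E.

End sobolev.

(* Main.v *)
From HB Require Import structures.
Require Import Defs.
From mathcomp Require Import all_boot all_order all_algebra.
From mathcomp Require Import all_classical all_reals all_analysis.
From mathcomp Require Import measurable_realfun.
From mathcomp Require Import ring lra.
Import Defs.

Set Implicit Arguments.
Unset Strict Implicit.
Unset Printing Implicit Defensive.

Import Order.TTheory GRing.Theory Num.Theory.
Import numFieldNormedType.Exports.

Local Open Scope classical_set_scope.
Local Open Scope ring_scope.

(** Let f be a test function with ||grad f||^n + kappa s <= 1 and
||f||^n <= s, all norms being L^n norms.  The local inequality is applied to the
part of f above the level A given by A^n = s / tau.  By Chebyshev's inequality
the set E where |f| > A has measure at most tau, and it is bounded because f has
compact support ([compact_rbounded]).  Off E the function is bounded by a
constant depending on tau and kappa only, and there exp_(n-2)[t] is at most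
t^(n-1) e^t, so the integrand is at most a constant times |f|^n, whose integral
is at most s <= 1 / kappa.

On E, the function |f| is compared with a = A softabs (f / A), where [softabs] is
smooth, vanishes on [-1, 1], has slope at most 1 and stays within 2 of the
absolute value.  So |f| <= a + 2 A, and a is again a test function, vanishing off
E, with |grad a| <= |grad f|.  Put theta = kappa s / 2.  The norm constraint
leaves ||grad f||^n <= 1 - theta, so that w = (1 - theta)^(-1/n) a still satisfies
||grad w|| <= 1.  Convexity of t^(n/(n-1)) at the weights theta and 1 - theta gives
([powR_add_le])
  |f|^(n/(n-1)) <= w^(n/(n-1)) + ((2 A)^n / theta)^(1/(n-1)),
and the last term equals (2^(n+1) / (tau kappa))^(1/(n-1)), whatever f is: the
cost of amplifying a is exactly what the term kappa s of the constraint pays for.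
The local inequality for w then bounds the integral over E ([ruf_one]).

A general u is a limit of test functions f_k for the Sobolev norm.  Scaling by
theta_j < 1 makes some f_(k_j) admissible ([W0_approx]), and choosing k_j with
||f_(k_j) - u||^n <= 2^(-j-1) forces convergence almost everywhere
([ae_cvg_of_fast_Lk]); Fatou's lemma concludes ([fatou_continuous]).

Three facts about manifolds support this.  Maps with continuous partial
derivatives are differentiable ([differentiable_C1]), so Jacobians of coordinate
changes obey the chain rule and gradients and their lengths can be computed in
any chart.  Hence gradients of test functions are measurable
([measurable_gradient]).  Finally, on a connected manifold compact sets have
finite diameter, since short coordinate segments have bounded length
([reach_near]). *)

(** * Directional derivatives and C^k functions *)

Section line.
Context (R : realType) (V : normedModType R).

Lemma is_derive_line (W : normedModType R) (f : V -> W) (x v : V) (t : R) d :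
  is_derive (t *: v + x) v f d <-> is_derive t 1 (fun s : R => f (s *: v + x)) d.
Proof.
have E : (fun h : R => h^-1 *: (((fun s : R => f (s *: v + x)) \o shift t) (h *: 1)
            - f (t *: v + x))) =
  (fun h : R => h^-1 *: ((f \o shift (t *: v + x)) (h *: v) - f (t *: v + x))).
  by apply/funext => h /=; rewrite [h *: 1]mulr1 scalerDl -addrA.
by split=> -[df <-]; apply: DeriveDef; move: df; rewrite /derivable /derive E.
Qed.

Lemma is_derive_comp_dir (h : R -> R) (f : V -> R) (x v : V) (dh df : R) :
  is_derive (f x) 1 h dh -> is_derive x v f df ->
  is_derive x v (h \o f) (dh * df).
Proof.
move=> hd; have {1 2}<- : 0 *: v + x = x by rewrite scale0r add0r.
move=> /is_derive_line fl; apply/is_derive_line.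
have {}hd : is_derive (f ((0 : R) *: v + x)) 1 h dh by rewrite scale0r add0r.
exact: (@is_derive1_comp R h (fun s : R => f (s *: v + x)) 0 dh df hd fl).
Qed.

(** When l is the derivative at x, this bounds the error of the linear
approximation along one direction by the oscillation of the derivative. *)
Lemma mean_value_dir (f : V -> R) (x e : V) (c l eps : R) :
  (forall t : R, `|t| <= `|c| -> derivable f (t *: e + x) e /\
     `|'D_e f (t *: e + x) - l| <= eps) ->
  `|f (c *: e + x) - f x - c * l| <= eps * `|c|.
Proof.
move=> H; pose g (s : R) : R := f (s *: e + x).
pose dg (s : R) : R := 'D_e f (s *: e + x).
have gd (s : R) : `|s| <= `|c| -> is_derive s 1 g (dg s).
  by move=> /H[fd _]; apply/is_derive_line/derivableP.
pose a := Num.min 0 c; pose b := Num.max 0 c.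
have ab : a <= b by rewrite /a /b ge_min !le_max lexx.
have absab (s : R) : a <= s <= b -> `|s| <= `|c|.
  rewrite /a /b => /andP[]; case: (leP 0 c) => c0 s1 s2.
    by rewrite !ger0_norm.
  by rewrite !ler0_norm ?lerN2// ltW.
have [z zab] : exists2 z, z \in `[a, b] & g b - g a = dg z * (b - a).
  apply: MVT_segment => //.
    by move=> s; rewrite in_itv/= => /andP[? ?]; apply/gd/absab; rewrite !ltW.
  apply: derivable_within_continuous => s; rewrite in_itv/= => /absab/gd[]//.
move: zab; rewrite in_itv/= => /absab/H[_ zl] E.
suff -> : f (c *: e + x) - f x - c * l = (dg z - l) * c.
  by rewrite normrM ler_wpM2r.
rewrite -[f x]/(f x) -{2}[x]add0r -[in f (0 + x)](scale0r e) -/(g c) -/(g 0).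
rewrite /a /b in E; case: (leP 0 c) E => c0 E.
  by rewrite E subr0 mulrBl [c * _]mulrC.
have -> : g c - g 0 = - (g 0 - g c) by rewrite opprB.
by rewrite E sub0r mulrN opprK mulrBl [c * _]mulrC.
Qed.

End line.

Section Ck.
Context (R : realType) (n : nat).
Implicit Types (U : set 'rV[R]_n) (f g : 'rV[R]_n -> R).

Lemma Ck_on_le k k' U f : (k' <= k)%N -> Ck_on k U f -> Ck_on k' U f.
Proof.
elim: k k' f => [|k IH] [|k'] f //= kk' [cf df]; split=> // i.
by have [d1 d2] := df i; split=> //; exact: IH.
Qed.

Lemma Ck_onS k U f : Ck_on k.+1 U f -> Ck_on k U f.
Proof. exact: Ck_on_le. Qed.

(** Each D_v f is a function on the whole space which depends on f near the point
only; as U is open, values of f outside U do not matter at any order. *)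
Lemma Ck_on_eq k U f g : open U -> {in U, f =1 g} -> Ck_on k U f -> Ck_on k U g.
Proof.
move=> oU; have near_fg f' g' x : {in U, f' =1 g'} -> U x -> {near x, f' =1 g'}.
  move=> fg Ux; apply: filterS (open_nbhs_nbhs (conj oU Ux)) => y Uy.
  exact/fg/mem_set.
have cont f' g' : {in U, f' =1 g'} -> {in U, continuous f'} ->
    {in U, continuous g'}.
  move=> fg cf x xU; rewrite /continuous_at -(fg x xU).
  exact: cvg_trans (near_eq_cvg (near_fg _ _ x fg (set_mem xU))) (cf x xU).
elim: k f g => [|k IH] f g fg [cf df]; first by split=> //; exact: cont fg cf.
split=> [|i]; first exact: cont fg cf.
have [d1 d2] := df i; split=> [x Ux|].
  by apply: near_eq_derivable (d1 x Ux); exact: near_fg fg _.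
apply: IH d2 => x /set_mem Ux; apply: near_eq_derive; exact: near_fg fg _.
Qed.

Lemma Ck_onD k U f g : open U -> Ck_on k U f -> Ck_on k U g ->
  Ck_on k U (fun x => f x + g x).
Proof.
move=> oU; elim: k f g => [|k IH] f g [cf df] [cg dg].
  by split=> // x xU; exact: continuousD (cf x xU) (cg x xU).
split=> [x xU|i]; first exact: continuousD (cf x xU) (cg x xU).
have [f1 f2] := df i; have [g1 g2] := dg i; split=> [x Ux|].
  by apply: derivableD; [exact: f1|exact: g1].
apply: Ck_on_eq oU _ (IH _ _ f2 g2) => x /set_mem Ux.
by rewrite [RHS](deriveD (f1 x Ux) (g1 x Ux)).
Qed.

Lemma Ck_onM k U f g : open U -> Ck_on k U f -> Ck_on k U g ->
  Ck_on k U (fun x => f x * g x).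
Proof.
move=> oU; elim: k f g => [|k IH] f g Hf Hg.
  have [[cf _] [cg _]] := (Hf, Hg).
  by split=> // x xU; exact: continuousM (cf x xU) (cg x xU).
have [cf df] := Hf; have [cg dg] := Hg.
split=> [x xU|i]; first exact: continuousM (cf x xU) (cg x xU).
have [f1 f2] := df i; have [g1 g2] := dg i; split=> [x Ux|].
  by apply: derivableM; [exact: f1|exact: g1].
apply: Ck_on_eq oU _ (Ck_onD oU (IH _ _ (Ck_onS Hf) g2) (IH _ _ (Ck_onS Hg) f2)).
by move=> x /set_mem Ux; rewrite [RHS](deriveM (f1 x Ux) (g1 x Ux)).
Qed.

(** The functions h j are the successive derivatives of h 0: the chain rule
replaces h j by h j.+1, so the induction on k must treat all j at once. *)
Lemma Ck_on_comp (h : nat -> R -> R) :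
  (forall j (t : R), is_derive t 1 (h j) (h j.+1 t)) ->
  forall k j U f, open U -> Ck_on k U f -> Ck_on k U (h j \o f).
Proof.
move=> hd k j U f oU Hf.
have hc m : continuous (h m).
  by move=> t; apply/differentiable_continuous/derivable1_diffP; case: (hd m t).
have cont m f' : {in U, continuous f'} -> {in U, continuous (h m \o f')}.
  by move=> cf x xU; apply: continuous_comp; [exact: cf|exact: hc].
elim: k j f Hf => [|k IH] j f Hf.
  by case: Hf => cf _; split=> //; exact: cont.
case: (Hf) => cf df; split=> [|i]; first exact: cont.
have [f1 f2] := df i.
have D x : U x -> is_derive x (delta_mx 0 i) (h j \o f)
     (h j.+1 (f x) * 'D_(delta_mx 0 i) f x).
  by move=> Ux; apply: is_derive_comp_dir; exact/derivableP/f1.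
split=> [x /D[]//|].
apply: Ck_on_eq oU _ (Ck_onM oU (IH j.+1 f (Ck_onS Hf)) f2).
by move=> x /set_mem /D Dx; rewrite derive_val.
Qed.

End Ck.

(** * Differentiability of C^1 maps *)

Section C1.
Context (R : realType) (n : nat).

(** The coordinates of h of index at least k are set to 0: as k grows from 0 to n,
the increment h is built up by moving one coordinate at a time. *)
Definition row_take (k : nat) (h : 'rV[R]_n) : 'rV[R]_n :=
  \row_i (if (i < k)%N then h 0 i else 0).

Lemma row_take0 h : row_take 0 h = 0.
Proof. by apply/rowP => i; rewrite !mxE. Qed.

Lemma row_take_full h : row_take n h = h.
Proof. by apply/rowP => i; rewrite !mxE ltn_ord. Qed.

Lemma row_takeS (h : 'rV[R]_n) (k : 'I_n) :
  row_take k.+1 h = h 0 k *: delta_mx 0 k + row_take k h.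
Proof.
apply/rowP => i; rewrite !mxE eqxx/= ltnS leq_eqVlt -val_eqE/=.
by case: ltngtP => /= ik; rewrite ?mulr0 ?add0r// mulr1 addr0;
  congr (h 0 _); apply/val_inj.
Qed.

Lemma coord_le_norm (h : 'rV[R]_n) i : `|h 0 i| <= `|h|.
Proof. by rewrite [leRHS]/Num.Def.normr/= mx_normrE; exact: (le_bigmax _ _ (0, i)). Qed.

Lemma row_norm_le (h : 'rV[R]_n) (r : R) : 0 <= r ->
  (forall i, `|h 0 i| <= r) -> `|h| <= r.
Proof.
move=> r0 H; rewrite [leLHS]/Num.Def.normr/= mx_normrE bigmax_le// => -[i j] _/=.
by rewrite ord1.
Qed.

Lemma norm_row_take_segment (h : 'rV[R]_n) (k : 'I_n) (t : R) : `|t| <= `|h 0 k| ->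
  `|t *: delta_mx 0 k + row_take k h : 'rV[R]_n| <= `|h|.
Proof.
move=> tk; apply: row_norm_le => // i; rewrite !mxE eqxx/= -val_eqE/=.
case: ltngtP => /= ik; rewrite ?mulr0 ?add0r ?normr0 ?coord_le_norm//.
by rewrite mulr1 addr0 (le_trans tk)// coord_le_norm.
Qed.

Definition lin_form (c : 'I_n -> R) (h : 'rV[R]_n) : R :=
  \sum_i h 0 i * c i.

Lemma lin_form_is_linear c : linear (lin_form c).
Proof.
move=> a u v; rewrite /lin_form scaler_sumr -big_split/=; apply: eq_bigr => i _.
by rewrite !mxE mulrDl -mulrA.
Qed.

Lemma lin_form_continuous c : continuous (lin_form c).
Proof.
move=> h; apply: differentiable_continuous.
have -> : lin_form c = \sum_i (fun h : 'rV[R]_n => h 0 i * c i).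
  by apply/funext => k; rewrite fct_sumE.
apply: differentiable_sum => i.
exact: differentiableM (differentiable_coord _ _ _) (differentiable_cst _ _).
Qed.

(** The increment of f is the sum over k of its increments from row_take k h to
row_take k.+1 h.  Each of these moves along one basis vector inside the ball of
radius |h|, where the mean value inequality compares it with h 0 k times the
partial derivative at x. *)
Lemma differentiable_C1 (f : 'rV[R]_n -> R) (x : 'rV[R]_n) :
  (forall i, \forall y \near x, derivable f y (delta_mx 0 i)) ->
  (forall i, {for x, continuous ('D_(delta_mx 0 i) f)}) ->
  differentiable f x.
Proof.
move=> df cf; pose c (i : 'I_n) : R := 'D_(delta_mx 0 i) f x.
have lc := @lin_form_continuous c.
pose L : {linear 'rV[R]_n -> R} :=
  HB.pack (lin_form c) (GRing.isLinear.Build _ _ _ _ _ (lin_form_is_linear c)).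
have dfE : f \o shift x = cst (f x) + L +o_ (0 : 'rV[R]_n) id.
  apply/eqaddoP => e e0.
  pose eps := e / n.+1%:R.
  have eps0 : 0 < eps by rewrite divr_gt0.
  have : \forall y \near x, forall i, derivable f y (delta_mx 0 i) /\
      `|'D_(delta_mx 0 i) f y - c i| <= eps.
    apply: (filter_forall (F := nbhs x)) => i; apply: filterI; first exact: df.
    by have /cvgrPdistC_le := cf i; apply.
  move=> /nbhs_ballP[r/= r0 rP].
  apply/nbhs_ballP; exists r => //= h.
  rewrite -ball_normE/= sub0r normrN => hr.
  pose F k := f (row_take k h + x).
  have -> : (f \o shift x - (cst (f x) + lin_form c)) h =
      \sum_(i < n) (F i.+1 - F i - h 0 i * c i).
    rewrite sumrB -(big_mkord xpredT (fun i => F i.+1 - F i)).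
    rewrite telescope_sumr// /F row_take0 add0r row_take_full.
    by rewrite /cst opprD addrA.
  apply: le_trans (ler_norm_sum _ _ _) _.
  apply: le_trans (_ : \sum_(i < n) eps * `|h| <= _); last first.
    rewrite sumr_const card_ord -mulr_natl mulrA ler_wpM2r// /eps.
    by rewrite mulrC -mulrA ler_piMr ?(ltW e0)// mulrC ler_pdivrMr// mul1r ler_nat.
  apply: ler_sum => i _; rewrite /F row_takeS -(addrA (h 0 i *: _)).
  apply: le_trans (_ : eps * `|h 0 i| <= _).
    apply: mean_value_dir => t ti; apply: rP.
    rewrite -ball_normE/= [t *: _ + _]addrA opprD addrCA subrr addr0 normrN.
    exact: le_lt_trans (norm_row_take_segment ti) hr.
  by rewrite ler_wpM2l ?(ltW eps0)// coord_le_norm.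
apply/diff_locallyP; have dE := diff_unique (lc : continuous L) dfE.
by rewrite dE; split.
Qed.

Lemma Ck_on_differentiable U (f : 'rV[R]_n -> R) x :
  open U -> Ck_on 1 U f -> U x -> differentiable f x.
Proof.
move=> oU [cf df] Ux; apply: differentiable_C1 => i; have [d1 [d2 _]] := df i.
  by apply: filterS (open_nbhs_nbhs (conj oU Ux)) => y; exact: d1.
exact/d2/mem_set.
Qed.

Lemma differentiable_row (V : normedModType R) (F : V -> 'rV[R]_n) x :
  (forall i, differentiable (fun y => F y 0 i) x) -> differentiable F x.
Proof.
move=> dF.
have -> : F = \sum_i (fun y => F y 0 i *: (delta_mx 0 i : 'rV[R]_n)).
  apply/funext => y; rewrite fct_sumE [LHS]row_sum_delta.
  by apply: eq_bigr.
by apply: differentiable_sum => i; exact: differentiableZl.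
Qed.

End C1.

Lemma Ck_on_differentiable_row (R : realType) (n m : nat) U
    (F : 'rV[R]_n -> 'rV[R]_m) x :
  open U -> (forall i, Ck_on 1 U (fun y => F y 0 i)) -> U x -> differentiable F x.
Proof.
move=> oU CF Ux; apply: differentiable_row => i.
exact: Ck_on_differentiable oU (CF i) Ux.
Qed.

(** * Changes of coordinates *)

(** The intermediate point is a variable y with a proof of f x = y, because
differentiability at f x cannot be rewritten into differentiability at y. *)
Lemma derive_comp (R : realType) (U V W : normedModType R) (f : U -> V)
    (g : V -> W) x y v :
  f x = y -> differentiable f x -> differentiable g y ->
  'D_v (g \o f) x = 'D_('D_v f x) g y.
Proof.
move=> <- df dg; apply: etrans (deriveE v (differentiable_comp df dg)) _.
rewrite diff_comp//=; apply: etrans (esym (deriveE _ dg)).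
by rewrite (deriveE v df).
Qed.

Section jacobian.
Context (R : realType) (m n k : nat).

Lemma jacobian_comp (f : 'rV[R]_m -> 'rV[R]_n) (g : 'rV[R]_n -> 'rV[R]_k) x y :
  f x = y -> differentiable f x -> differentiable g y ->
  differentiable (g \o f) x /\ 'J (g \o f) x = 'J f x *m 'J g y.
Proof.
move=> <- df dg; split; first exact: differentiable_comp.
by apply/row_matrixP => i; rewrite !rowE mulmxA /jacobian !mul_rV_lin1 diff_comp.
Qed.

Lemma row_jacobian (f : 'rV[R]_m -> 'rV[R]_n) x i : differentiable f x ->
  row i ('J f x) = 'D_(delta_mx 0 i) f x.
Proof. by move=> df; rewrite rowE /jacobian mul_rV_lin1 deriveE. Qed.

(** A composition of two coordinate changes agrees with the direct coordinate
change near the point only. *)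
Lemma jacobian_near_eq (f g : 'rV[R]_m -> 'rV[R]_n) x :
  differentiable f x -> differentiable g x -> {near x, f =1 g} ->
  'J f x = 'J g x.
Proof.
move=> df dg fg; apply/row_matrixP => i; apply: etrans (row_jacobian i df) _.
by apply: etrans (esym (row_jacobian i dg)); exact: near_eq_derive.
Qed.

Lemma derive_partials (f : 'rV[R]_m -> R) x v : differentiable f x ->
  'D_v f x = \sum_i v 0 i * 'D_(delta_mx 0 i) f x.
Proof.
move=> df; rewrite deriveE// {1}[v]row_sum_delta linear_sum; apply: eq_bigr => i _.
by rewrite linearZ deriveE.
Qed.

End jacobian.

Lemma jacobian_id (R : realType) (m : nat) (x : 'rV[R]_m) : 'J id x = 1%:M.
Proof.
apply/row_matrixP => i; apply: etrans (row_jacobian i (ex_diff (f := id))) _.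
by rewrite derive_id rowE mulmx1.
Qed.

Section charts.
Context (R : realType) (n : nat) (M : topologicalType).
Implicit Types (c : chart R n M) (p q : M).

Lemma cdomK c p : cdom c p -> cinv c (cfun c p) = p.
Proof. by move=> /mem_set; exact: cfunK. Qed.

Lemma cimgK c x : cimg c x -> cfun c (cinv c x) = x.
Proof. by move=> [p cp <-]; rewrite cdomK. Qed.

Lemma cinv_dom c x : cimg c x -> cdom c (cinv c x).
Proof. by move=> [p cp <-]; rewrite cdomK. Qed.

Lemma cfun_img c p : cdom c p -> cimg c (cfun c p).
Proof. by exists p. Qed.

Lemma nbhs_cdom c p : cdom c p -> nbhs p (cdom c).
Proof. by move=> cp; apply: open_nbhs_nbhs; split => //; exact: cdom_open. Qed.

Lemma nbhs_cimg c x : cimg c x -> nbhs x (cimg c).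
Proof. by move=> cx; apply: open_nbhs_nbhs; split => //; exact: cimg_open. Qed.

Lemma cvg_cfun c p : cdom c p -> {for p, continuous (cfun c)}.
Proof. by move=> /mem_set; exact: cfun_continuous. Qed.

Lemma cvg_cinv c x : cimg c x -> {for x, continuous (cinv c)}.
Proof. by move=> /mem_set; exact: cinv_continuous. Qed.

Lemma nbhs_cinv c p A : cdom c p -> nbhs p A ->
  \forall x \near cfun c p, A (cinv c x).
Proof.
by move=> cp pA; apply: (cvg_cinv (cfun_img cp)); rewrite cdomK.
Qed.

Lemma open_cfun_image c (A : set M) : open A -> open (cfun c @` (cdom c `&` A)).
Proof.
move=> oA; rewrite openE => _ [p [cp Ap] <-]; rewrite /interior.
have := nbhs_cinv cp (open_nbhs_nbhs (conj oA Ap)).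
have := nbhs_cimg (cfun_img cp); apply: filterS2 => x cx Ax.
by exists (cinv c x); [split=> //; exact: cinv_dom|exact: cimgK].
Qed.

End charts.

Section manifold.
Context (R : realType) (n : nat) (M : topologicalType)
        (S : smooth_manifold R n M).
Implicit Types (c : chart R n M) (p q : M) (u : M -> R).

Lemma transition_differentiable c c' p : atlas S c -> atlas S c' ->
  cdom c p -> cdom c' p -> differentiable (cfun c' \o cinv c) (cfun c p).
Proof.
move=> Sc Sc' cp c'p.
apply: (@Ck_on_differentiable_row _ _ _ (cfun c @` (cdom c `&` cdom c'))).
- exact/open_cfun_image/cdom_open.
- by move=> i; exact: (transition_smooth Sc Sc' i 1%N).
- by exists p.
Qed.

Lemma coord_change_comp c1 c2 c3 p : atlas S c1 -> atlas S c2 -> atlas S c3 ->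
  cdom c1 p -> cdom c2 p -> cdom c3 p ->
  coord_change c1 c2 p *m coord_change c2 c3 p = coord_change c1 c3 p.
Proof.
move=> S1 S2 S3 d1 d2 d3.
have D12 := transition_differentiable S1 S2 d1 d2.
have D23 := transition_differentiable S2 S3 d2 d3.
have E : (cfun c2 \o cinv c1) (cfun c1 p) = cfun c2 p by rewrite /= cdomK.
have [dc <-] := jacobian_comp E D12 D23.
apply: jacobian_near_eq dc (transition_differentiable S1 S3 d1 d3) _.
by apply: filterS (nbhs_cinv d1 (nbhs_cdom d2)) => x /= c2x; rewrite cdomK.
Qed.

Lemma coord_change_id c p : atlas S c -> cdom c p -> coord_change c c p = 1%:M.
Proof.
move=> Sc cp; rewrite -(jacobian_id (cfun c p)).
have E : {near cfun c p, cfun c \o cinv c =1 id}.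
  by apply: filterS (nbhs_cimg (cfun_img cp)) => x; exact: cimgK.
by apply: jacobian_near_eq E; [exact: transition_differentiable|exact: ex_diff].
Qed.

Lemma coord_changeK c c' p : atlas S c -> atlas S c' -> cdom c p -> cdom c' p ->
  coord_change c c' p *m coord_change c' c p = 1%:M.
Proof. by move=> *; rewrite coord_change_comp// coord_change_id. Qed.

Definition chart_differential c u p : 'rV[R]_n :=
  \row_i 'D_(delta_mx 0 i) (u \o cinv c) (cfun c p).

Lemma smooth_fun_differentiable u c p : smooth_fun S u -> atlas S c ->
  cdom c p -> differentiable (u \o cinv c) (cfun c p).
Proof.
move=> su Sc cp; apply: (@Ck_on_differentiable _ _ (cimg c)).
- exact: cimg_open.
- exact: su.
- exact: cfun_img.
Qed.

(** Coordinates of tangent vectors are multiplied by the Jacobian, those of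
covectors by its transpose in the opposite direction. *)
Lemma chart_differential_change u c c' p : smooth_fun S u ->
  atlas S c -> atlas S c' -> cdom c p -> cdom c' p ->
  chart_differential c u p = chart_differential c' u p *m (coord_change c c' p)^T.
Proof.
move=> su Sc Sc' cp c'p.
have dT := transition_differentiable Sc Sc' cp c'p.
have du := smooth_fun_differentiable su Sc' c'p.
have E : (cfun c' \o cinv c) (cfun c p) = cfun c' p by rewrite /= cdomK.
have nE : {near cfun c p, u \o cinv c =1 (u \o cinv c') \o (cfun c' \o cinv c)}.
  by apply: filterS (nbhs_cinv cp (nbhs_cdom c'p)) => x /= c2x; rewrite cdomK.
apply/rowP => i; rewrite mxE (near_eq_derive _ nE) (derive_comp _ E dT du).
rewrite (derive_partials _ du) [RHS]mxE; apply: eq_bigr => j _.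
have -> : chart_differential c' u p 0 j =
  'D_(delta_mx 0 j) (u \o cinv c') (cfun c' p) by rewrite mxE.
rewrite mulrC; congr (_ * _); rewrite -(row_jacobian i dT).
by rewrite [LHS]mxE [RHS]mxE.
Qed.

Lemma smooth_fun_continuous u : smooth_fun S u -> continuous u.
Proof.
move=> su p; pose c := chart_at S p.
have cp : cdom c p := chart_at_dom S p.
have /differentiable_continuous uc :=
  smooth_fun_differentiable su (chart_at_atlas S p) cp.
rewrite /continuous_at -{2}(cdomK cp).
have : (u \o cinv c) \o cfun c @ p --> (u \o cinv c) (cfun c p).
  exact: continuous_comp (cvg_cfun cp) uc.
apply: cvg_trans; apply: near_eq_cvg.
by apply: filterS (nbhs_cdom cp) => x cx /=; rewrite cdomK.
Qed.

End manifold.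

Section metric.
Context (R : realType) (n : nat) (M : topologicalType)
        (S : smooth_manifold R n M) (g : riemannian_metric S).
Implicit Types (c : chart R n M) (p q : M) (u : M -> R) (v w : 'rV[R]_n).

Definition ginner p v w : R := (v *m metric g p *m w^T) 0 0.

Lemma gnormE p v : gnorm g p v = Num.sqrt (ginner p v v).
Proof. by []. Qed.

Lemma ginnerDl p a v v' w :
  ginner p (a *: v + v') w = a * ginner p v w + ginner p v' w.
Proof. by rewrite /ginner !mulmxDl -!scalemxAl !mxE. Qed.

Lemma ginnerC p v w : ginner p v w = ginner p w v.
Proof.
have -> : ginner p v w = ((v *m metric g p *m w^T)^T) 0 0 by rewrite mxE.
by rewrite !trmx_mul trmxK metric_sym mulmxA.
Qed.

Lemma ginner_ge0 p v : 0 <= ginner p v v.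
Proof.
have [->|v0] := eqVneq v 0; first by rewrite /ginner !mul0mx mxE.
exact/ltW/metric_pos.
Qed.

Lemma ginner_gt0 p v : v != 0 -> 0 < ginner p v v.
Proof. exact: metric_pos. Qed.

Lemma gnorm_ge0 p v : 0 <= gnorm g p v.
Proof. exact: sqrtr_ge0. Qed.

Lemma sqr_gnorm p v : gnorm g p v ^+ 2 = ginner p v v.
Proof. by rewrite gnormE sqr_sqrtr// ginner_ge0. Qed.

Lemma ginnerDr p a v w w' :
  ginner p v (a *: w + w') = a * ginner p v w + ginner p v w'.
Proof. by rewrite ginnerC ginnerDl !(ginnerC p v). Qed.

Lemma gnormZ p a v : gnorm g p (a *: v) = `|a| * gnorm g p v.
Proof.
rewrite !gnormE /ginner linearZ/= -!scalemxAl -scalemxAr scalerA mxE -expr2.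
by rewrite sqrtrM ?sqr_ge0// sqrtr_sqr.
Qed.

(** The Cauchy-Schwarz inequality: the form is nonnegative at v - t w for the
minimizing t = (v, w) / (w, w). *)
Lemma ginner_le p v w : ginner p v w <= gnorm g p v * gnorm g p w.
Proof.
have [->|w0] := eqVneq w 0.
  by rewrite -(scale0r 0) gnormZ normr0 mul0r mulr0 /ginner scale0r trmx0 mulmx0 mxE.
have ww := ginner_gt0 p w0.
pose t := ginner p v w / ginner p w w.
have tw : t * ginner p w w = ginner p v w by rewrite /t divfK ?gt_eqF.
have H : ginner p v w ^+ 2 <= ginner p v v * ginner p w w.
  have := ginner_ge0 p (- t *: w + v).
  rewrite ginnerDl !ginnerDr (ginnerC p w v) => H.
  have {}H : 0 <= ginner p v v - t * ginner p v w by move: H; rewrite -tw; lra.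
  have := mulr_ge0 H (ltW ww).
  by rewrite mulrBl mulrAC tw -expr2 subr_ge0.
apply: le_trans (ler_norm _) _.
by rewrite -ler_sqr ?nnegrE ?mulr_ge0 ?gnorm_ge0// real_normK ?num_real// exprMn !sqr_gnorm.
Qed.

Lemma gnormD p v w : gnorm g p (v + w) <= gnorm g p v + gnorm g p w.
Proof.
rewrite -ler_sqr ?nnegrE ?addr_ge0 ?gnorm_ge0// sqrrD !sqr_gnorm.
have := ginner_le p v w.
have := ginnerDl p 1 v w (v + w); have := ginnerDr p 1 v v w.
have := ginnerDr p 1 w v w; rewrite !scale1r (ginnerC p w v) => -> -> ->.
lra.
Qed.

Lemma gnorm0 p : gnorm g p 0 = 0.
Proof. by rewrite -(scale0r 0) gnormZ normr0 mul0r. Qed.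

Lemma metric_unit p : metric g p \in unitmx.
Proof.
rewrite -row_free_unit -kermx_eq0; apply/eqP/row_matrixP => i; rewrite row0.
apply/eqP; apply: contraT => /(metric_pos g p).
by rewrite -row_mul mulmx_ker row0 mul0mx mxE ltxx.
Qed.

Lemma form_in_chart_unit c p : atlas S c -> cdom c p ->
  form_in_chart S (metric g) c p \in unitmx.
Proof.
move=> Sc cp.
have := coord_changeK Sc (chart_at_atlas S p) cp (chart_at_dom S p).
move=> /mulmx1_unit[Au _].
by rewrite /form_in_chart !unitmx_mul unitmx_tr Au metric_unit.
Qed.

(** The chart distinguished at p depends on p in an arbitrary way, so the vector
gradient g u p has no regularity in p by itself.  Its components in a fixed chart
are smooth functions of the partial derivatives of u and of the matrix of the
metric in that chart. *)
Lemma gradient_in_chart c p u : smooth_fun S u -> atlas S c -> cdom c p ->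
  gradient g u p *m coord_change (chart_at S p) c p =
  chart_differential c u p *m invmx (form_in_chart S (metric g) c p).
Proof.
move=> su Sc cp; set c0 := chart_at S p.
have S0 : atlas S c0 := chart_at_atlas S p.
have c0p : cdom c0 p := chart_at_dom S p.
rewrite /gradient -[differential S u p]/(chart_differential c0 u p).
rewrite (chart_differential_change su S0 Sc c0p cp).
rewrite /form_in_chart -/c0; set A := coord_change c c0 p.
set B := coord_change c0 c p.
have AB : A *m B = 1%:M := coord_changeK Sc S0 cp c0p.
have BA : B *m A = 1%:M := coord_changeK S0 Sc c0p cp.
apply: (canRL (mulmxK _)); first exact: form_in_chart_unit.
rewrite -!mulmxA (mulmxA B) BA mul1mx (mulmxA (invmx _)) mulVmx ?metric_unit//.
by rewrite mul1mx -trmx_mul AB trmx1 mulmx1.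
Qed.

(** The metric in the chart is A g A^T with A inverse to the coordinate change B,
hence (v B) (A g A^T) (v B)^T = v g v^T. *)
Lemma gnorm_in_chart c p v : atlas S c -> cdom c p ->
  let w := v *m coord_change (chart_at S p) c p in
  gnorm g p v = Num.sqrt ((w *m form_in_chart S (metric g) c p *m w^T) 0 0).
Proof.
move=> Sc cp /=; set c0 := chart_at S p.
have S0 : atlas S c0 := chart_at_atlas S p.
have c0p : cdom c0 p := chart_at_dom S p.
rewrite /form_in_chart -/c0; set A := coord_change c c0 p.
set B := coord_change c0 c p.
have BA : B *m A = 1%:M := coord_changeK S0 Sc c0p cp.
rewrite gnormE /ginner trmx_mul; congr (Num.sqrt (_ 0 0)).
have BAT : A^T *m B^T = 1%:M by rewrite -trmx_mul BA trmx1.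
rewrite -!mulmxA (mulmxA B) BA mul1mx.
by rewrite (mulmxA A^T) BAT mul1mx.
Qed.

End metric.

(** * Riemannian distance on compact sets *)

(** The integral of a nonnegative function is a supremum over the simple functions
below it, hence monotone for arbitrary functions. *)
Lemma ge0_le_integral_any d (T : measurableType d) (R : realType)
    (mu : {measure set T -> \bar R}) (D : set T) (f1 f2 : T -> \bar R) :
  (forall x, D x -> (0 <= f1 x)%E) -> (forall x, D x -> (f1 x <= f2 x)%E) ->
  (\int[mu]_(x in D) f1 x <= \int[mu]_(x in D) f2 x)%E.
Proof.
move=> f10 f12.
have f20 x : D x -> (0 <= f2 x)%E by move=> Dx; apply: le_trans (f12 _ Dx); exact: f10.
rewrite !ge0_integralE//; apply: le_ereal_sup => _ [h/= hf <-]; exists h => //= x.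
apply: le_trans (hf x) _; rewrite /patch; case: ifPn => // /set_mem; exact: f12.
Qed.

Section loop_param.
Context (R : realType).

(** A C^1 map of the line into [-1, 1] through 0 and 1 at 0 and 1: it
reparametrizes a segment into a curve defined for all times. *)
Definition sweep (t : R) : R := 2 * t / (1 + t ^+ 2).
Definition dsweep (t : R) : R := (2 - 2 * t ^+ 2) / (1 + t ^+ 2) ^+ 2.

Lemma sweep_den_gt0 (t : R) : 0 < 1 + t ^+ 2.
Proof. by rewrite ltr_pwDl// sqr_ge0. Qed.

Lemma sweep0 : sweep 0 = 0. Proof. by rewrite /sweep mulr0 mul0r. Qed.

Lemma sweep1 : sweep 1 = 1.
Proof. by rewrite /sweep mulr1 expr1n divff. Qed.

Lemma sweep_le1 (t : R) : `|sweep t| <= 1.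
Proof.
have d0 := sweep_den_gt0 t.
rewrite /sweep normrM normfV (gtr0_norm d0) ler_pdivrMr// mul1r ler_norml.
have := sqr_ge0 (t - 1); have := sqr_ge0 (t + 1).
by rewrite sqrrD sqrrB => A B; apply/andP; split; lra.
Qed.

Lemma is_derive_sweep (t : R) : is_derive t 1 sweep (dsweep t).
Proof.
have d0 : 1 + t ^+ 2 != 0 by rewrite gt_eqF ?sweep_den_gt0.
pose q : R -> R := cst 1 + id ^+ 2.
have qE s : q s = 1 + s ^+ 2 by rewrite /q fctE exprfctE.
have dq : is_derive t 1 q (2 * t).
  have -> : 2 * t = 0 + (2%:R * id t ^+ 1) *: 1 by rewrite add0r [_ *: 1]mulr1 expr1.
  exact: is_deriveD.
have [dq1 dq2] := dq.
have qt0 : q t != 0 by rewrite qE.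
have dV : is_derive t 1 (fun s => (q s)^-1) (- (q t) ^- 2 *: (2 * t)).
  by apply: DeriveDef; [exact: derivableV|rewrite deriveV// dq2].
have dN : is_derive t 1 (fun s : R => 2 * s) 2.
  have dI : is_derive t 1 (2 \*: id) (2 *: (1 : R)) := is_deriveZ 2 (is_derive_id t 1).
  by rewrite -[2 in X in is_derive _ _ _ X]mulr1.
have -> : @sweep = (fun s => 2 * s) * (fun s => (q s)^-1).
  by apply/funext => s; rewrite /sweep -qE.
apply: is_derive_eq; rewrite /dsweep qE.
by have scaleE (a b : R) : a *: b = a * b := erefl; rewrite !scaleE; field.
Qed.

Lemma dsweep_le2 (t : R) : `|dsweep t| <= 2.
Proof.
have d0 := sweep_den_gt0 t; have t2 := sqr_ge0 t.
rewrite /dsweep normrM normfV (ger0_norm (sqr_ge0 _)) ler_pdivrMr ?exprn_gt0//.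
rewrite ler_norml expr2; apply/andP; split; nra.
Qed.

Lemma dsweep_continuous : continuous dsweep.
Proof.
move=> t.
rewrite /continuous_at; apply: cvgM.
  by apply: cvgB; [exact: cvg_cst|apply: cvgM; [exact: cvg_cst|exact: exprn_continuous]].
apply: cvgV; first by rewrite expf_neq0// gt_eqF ?sweep_den_gt0.
have sc : {for t, continuous (fun s : R => 1 + s ^+ 2)}.
  by apply: cvgD; [exact: cvg_cst|exact: exprn_continuous].
exact: (continuous_comp sc (@exprn_continuous _ 2 _)).
Qed.

End loop_param.

Lemma cvg_row (R : realType) (n : nat) (T : Type) (F : set_system T)
    {FF : Filter F} (f : T -> 'rV[R]_n) (l : 'rV[R]_n) :
  (forall i, f x 0 i @[x --> F] --> l 0 i) -> f @ F --> l.
Proof.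
move=> fl; apply/cvgrPdist_le => e e0.
have : \forall x \near F, forall i, `|l 0 i - f x 0 i| <= e.
  apply: filter_forall => i; have /cvgrPdist_le := fl i; exact.
apply: filterS => x xe; apply: row_norm_le (ltW e0) _ => i.
by have := xe i; rewrite !mxE.
Qed.

Lemma continuous_sum (R : realType) (T : topologicalType) (I : finType)
    (F : I -> T -> R) (x : T) : (forall i, {for x, continuous (F i)}) ->
  {for x, continuous (fun y => \sum_i F i y)}.
Proof.
have -> : (fun y => \sum_i F i y) = \sum_i F i by apply/funext => y; rewrite fct_sumE.
move=> Fc; elim/big_ind : _ => [|f h fc hc|i _]; last exact: Fc.
  exact: cvg_cst.
exact: continuousD fc hc.
Qed.

Section reach.
Context (R : realType) (n : nat) (M : topologicalType)
        (S : smooth_manifold R n M) (g : riemannian_metric S).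
Implicit Types (c : chart R n M) (p q : M).

(** An actual path is kept, instead of a bound on the infimum, so that bounds add
up by concatenating paths. *)
Definition reach (r : R) p q :=
  exists2 l, path_length g p q l & (l <= r%:E)%E.

Lemma path_length_cat p q l : path_length g p q l ->
  forall q' l', path_length g q q' l' -> path_length g p q' (l + l')%E.
Proof.
elim=> {p q l} [p|y q l Cy yq IH] q' l' ql'; first by rewrite add0e.
by rewrite -addeA; apply: path_cons Cy (IH _ _ ql').
Qed.

Lemma reach_trans r r' p q q' : reach r p q -> reach r' q q' -> reach (r + r') p q'.
Proof.
move=> [l pl lr] [l' pl' lr']; exists (l + l')%E.
  exact: path_length_cat pl _ _ pl'.
by rewrite EFinD leeD.
Qed.

Lemma reach_refl p : reach 0 p p.
Proof. by exists 0%E => //; constructor. Qed.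

Lemma reach_le r r' p q : r <= r' -> reach r p q -> reach r' p q.
Proof.
by move=> rr' [l pl lr]; exists l => //; apply: le_trans lr _; rewrite lee_fin.
Qed.

Lemma reach_rdist r p q : reach r p q -> (rdist g p q <= r%:E)%E.
Proof. by move=> [l pl lr]; apply: le_trans lr; exact: ereal_inf_lbound. Qed.

Section segment.
Context (c : chart R n M) (a v : 'rV[R]_n) (K : R).
Hypothesis Sc : atlas S c.
Hypothesis seg : forall s : R, `|s| <= 1 -> cimg c (s *: v + a).

Let z (t : R) := sweep t *: v + a.
Let y (t : R) := cinv c (z t).

Let zimg t : cimg c (z t). Proof. exact/seg/sweep_le1. Qed.

Let ydom t : cdom c (y t). Proof. exact: cinv_dom. Qed.

Let cy t : cfun c (y t) = z t. Proof. exact: cimgK. Qed.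

Let is_derive_z (t : R) : is_derive t 1 z (dsweep t *: v).
Proof.
have [dk Dk] := is_derive_sweep t.
have dk' : differentiable (@sweep R) t by apply/derivable1_diffP.
have dZ := differentiableZl v dk'.
have -> : z = (fun s => sweep s *: v) + cst a by [].
rewrite -[_ *: v]addr0; apply: is_deriveD; apply: DeriveDef.
  exact: diff_derivable.
by rewrite (deriveE (1 : R) dZ) (diffZl v dk') -(deriveE (1 : R) dk') Dk.
Qed.

Let z_continuous : continuous z.
Proof.
move=> t; apply: differentiable_continuous; apply/derivable1_diffP.
by case: (is_derive_z t).
Qed.

Let y_continuous : continuous y.
Proof. 
move=> t; apply: (@continuous_comp R 'rV[R]_n M z (cinv c)).
  exact: z_continuous.
exact: cvg_cinv.
Qed.

(* Any two charts differ by a C^1 map, so it is enough that the curve is a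
   reparametrized segment in the chart c. *)
Let is_derive_y c' (t : R) : atlas S c' -> cdom c' (y t) ->
  is_derive t 1 (cfun c' \o y) (dsweep t *: 'D_v (cfun c' \o cinv c) (z t)).
Proof.
move=> Sc' c'y.
have dT : differentiable (cfun c' \o cinv c) (z t).
  by have := transition_differentiable Sc Sc' (ydom t) c'y; rewrite cy.
have [dz Dz] := is_derive_z t.
have dz' : differentiable z t by apply/derivable1_diffP.
apply: DeriveDef; first exact/derivable1_diffP/(differentiable_comp dz' dT).
apply: etrans (derive_comp (1 : R) erefl dz' dT) _.
rewrite Dz (deriveE _ dT) linearZ/=; congr (_ *: _).
exact: esym (deriveE _ dT).
Qed.

Let y_C1 : C1_curve S y.
Proof.
split; first exact: y_continuous.
move=> c' Sc' t c'y; have [dy Dy] := is_derive_y Sc' c'y; split; first exact: dy.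
set T := cfun c' \o cinv c.
pose O := cfun c @` (cdom c `&` cdom c').
have oO : open O by exact/open_cfun_image/cdom_open.
have OzP s : cdom c' (y s) -> O (z s) by move=> c's; exists (y s).
have CT i : Ck_on 1 O (fun x => T x 0 i) := transition_smooth Sc Sc' i 1%N.
pose D (x : 'rV[R]_n) : 'rV[R]_n :=
  \row_i \sum_j v 0 j * 'D_(delta_mx 0 j) (fun x => T x 0 i) x.
have DE x : O x -> 'D_v T x = D x.
  move=> Ox.
  have dT : differentiable T x := Ck_on_differentiable_row oO CT Ox.
  rewrite derive_mx; last exact: diff_derivable.
  apply/rowP => i; rewrite !mxE derive_partials//.
  exact: Ck_on_differentiable oO (CT i) Ox.
have Dc x : O x -> {for x, continuous D}.
  move=> Ox; apply: (cvg_row (F := nbhs x)) => i; rewrite [X in _ --> X]mxE.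
  rewrite (_ : (fun x => D x 0 i) =
    fun x => \sum_j v 0 j * 'D_(delta_mx 0 j) (fun x => T x 0 i) x); last first.
    by apply/funext => x'; rewrite mxE.
  apply: continuous_sum => j.
  have cD : {for x, continuous ('D_(delta_mx 0 j) (fun x => T x 0 i))}.
    by have [_ /(_ j)[_ [+ _]]] := CT i; apply; exact: mem_set.
  exact (continuous_comp cD (@mulrl_continuous _ (v 0 j) _)).
have near_y : \forall s \near t, derive1 (cfun c' \o y) s = dsweep s *: D (z s).
  have : nbhs t (y @^-1` cdom c') by apply: y_continuous; exact: nbhs_cdom.
  apply: filterS => s c's.
  by have [_ Ds] := is_derive_y Sc' c's; rewrite derive1E Ds DE//; exact: OzP.
have Dzc : {for t, continuous (D \o z)}.
  apply: continuous_comp; [exact: z_continuous|exact/Dc/OzP].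
have lim : (fun s => dsweep s *: D (z s)) @ t --> dsweep t *: D (z t).
  exact: cvgZ (@dsweep_continuous R t) Dzc.
have E := nbhs_singleton near_y; rewrite /= in E.
rewrite /prop_for /continuous_at E; apply: cvg_trans lim.
by apply: near_eq_cvg; apply: filterS near_y => s ->.
Qed.

Let gnorm_velocity t : gnorm g (y t) (velocity S y t) =
  `|dsweep t| * Num.sqrt ((v *m form_in_chart S (metric g) c (y t) *m v^T) 0 0).
Proof.
have Sc0 := chart_at_atlas S (y t); have c0y := chart_at_dom S (y t).
rewrite /velocity derive1E; have [_ ->] := is_derive_y Sc0 c0y.
rewrite gnormZ (gnorm_in_chart _ _ Sc (ydom t)).
have dT := transition_differentiable Sc Sc0 (ydom t) c0y.
have DE : 'D_v (cfun (chart_at S (y t)) \o cinv c) (z t) =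
    v *m coord_change c (chart_at S (y t)) (y t).
  by rewrite /coord_change cy; rewrite cy in dT; exact: deriveEjacobian v dT.
rewrite DE; move: (coord_changeK Sc Sc0 (ydom t) c0y).
move: (coord_change c _ _) (coord_change _ c _) => A B AB.
by have -> : v *m A *m B = v by rewrite -mulmxA AB mulmx1.
Qed.

(** In the chart c the velocity is dsweep t times v, and |dsweep t| <= 2. *)
Lemma segment_reach : 
  (forall s : R, `|s| <= 1 ->
   (v *m form_in_chart S (metric g) c (cinv c (s *: v + a)) *m v^T) 0 0 <= K) ->
  reach (2 * Num.sqrt K) (cinv c a) (cinv c (v + a)).
Proof.
move=> HK.
have y0 : y 0 = cinv c a by rewrite /y /z sweep0 scale0r add0r.
have y1 : y 1 = cinv c (v + a) by rewrite /y /z sweep1 scale1r.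
rewrite -y0 -y1; exists (curve_length g y + 0)%E.
  exact: path_cons y_C1 (path_nil _ _).
rewrite adde0 /curve_length.
apply: le_trans (_ : (\int[lebesgue_measure]_(t in `[0%R, 1%R])
   (cst (2 * Num.sqrt K)%:E t) <= _)%E).
  apply: ge0_le_integral_any => t _; rewrite lee_fin ?gnorm_ge0//.
  rewrite gnorm_velocity ler_pM ?sqrtr_ge0 ?dsweep_le2//.
  by apply: ler_wsqrtr; apply: HK; exact: sweep_le1.
rewrite integral_cst//= lebesgue_measure_itv/= lte_fin ltr01 -EFinB subr0.
by rewrite mule1.
Qed.

End segment.
End reach.
Section reach2.
Context (R : realType) (n : nat) (M : topologicalType)
        (S : smooth_manifold R n M) (g : riemannian_metric S).
Implicit Types (c : chart R n M) (p q : M).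

Lemma quadratic_form_le (G : 'M[R]_n) (v : 'rV[R]_n) (r K : R) :
  (forall i, `|v 0 i| <= r) -> (forall i j, `|G i j| <= K) ->
  (v *m G *m v^T) 0 0 <= \sum_(i < n) \sum_(j < n) r * K * r.
Proof.
move=> vr GK; rewrite mxE; apply: ler_sum => i _.
rewrite !mxE mulr_suml; apply: ler_sum => j _.
apply: le_trans (ler_norm _) _.
by rewrite !normrM !ler_pM ?mulr_ge0.
Qed.

(** Near a point all segments of a chart are curves of uniformly bounded
length. *)
Lemma reach_near p : exists K : R, \forall q \near p, reach g K p q /\ reach g K q p.
Proof.
pose c := chart_at S p; have Sc : atlas S c := chart_at_atlas S p.
have cp : cdom c p := chart_at_dom S p.
set x0 := cfun c p.
have x0c : cimg c x0 := cfun_img cp.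
pose G (x : 'rV[R]_n) := form_in_chart S (metric g) c (cinv c x).
pose K := 1 + \sum_i \sum_j `|G x0 i j|.
have GK : \forall x \near x0, cimg c x /\ forall i j, `|G x i j| <= K.
  apply: (filterI (nbhs_cimg x0c)).
  apply: (filter_forall (F := nbhs x0)) => i; apply: (filter_forall (F := nbhs x0)) => j.
  have [Gc _] := metric_smooth g Sc i j 0%N.
  have /cvgrPdistC_le/(_ 1 ltr01) := Gc _ (mem_set x0c).
  apply: filterS => x Gx.
  apply: le_trans (_ : 1 + `|G x0 i j| <= _).
    rewrite -lerBlDr; apply: le_trans Gx.
    by rewrite (le_trans (lerB_dist _ _)).
  rewrite lerD2l (bigD1 i)//= (bigD1 j)//= -addrA lerDl addr_ge0//.
    by rewrite sumr_ge0.
  by rewrite sumr_ge0// => k _; rewrite sumr_ge0.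
move: GK => /nbhs_ballP[r/= r0 rP].
pose L := 2 * Num.sqrt (\sum_(i < n) \sum_(j < n) r * K * r).
have r20 : 0 < r / 2 by rewrite divr_gt0.
have cvl : \forall q \near p, cdom c q /\ ball x0 (r / 2) (cfun c q).
  apply: (filterI (nbhs_cdom cp)); apply: (cvg_cfun cp).
  exact: nbhsx_ballx.
have main a v : (forall s : R, `|s| <= 1 -> ball x0 r (s *: v + a)) -> `|v| <= r ->
    reach g L (cinv c a) (cinv c (v + a)).
  move=> sr vr; apply: segment_reach => // s s1; first by have [] := rP _ (sr s s1).
  have [_ Gs] := rP _ (sr s s1).
  apply: quadratic_form_le => // i; exact: le_trans (coord_le_norm _ _) vr.
exists L; apply: filterS cvl => q [cq].
set x1 := cfun c q; rewrite -ball_normE/= => x01.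
have x01' : `|x1 - x0| < r / 2 by rewrite distrC.
have lr : r / 2 <= r by rewrite ler_pdivrMr// mulr_natr mulr2n lerDl ltW.
have nr (s : R) (v : 'rV[R]_n) : `|s| <= 1 -> `|v| < r / 2 -> `|s *: v| < r / 2.
  by move=> s1 v1; rewrite normrZ; apply: le_lt_trans v1; rewrite ler_piMl.
split.
- have -> : p = cinv c x0 by rewrite /x0 cdomK.
  have -> : q = cinv c ((x1 - x0) + x0) by rewrite subrK /x1 cdomK.
  apply: main; last by rewrite (le_trans (ltW x01')).
  move=> s s1; rewrite -ball_normE/= opprD addrCA subrr addr0 normrN.
  exact: lt_le_trans (nr _ _ s1 x01') lr.
- have -> : q = cinv c x1 by rewrite /x1 cdomK.
  have -> : p = cinv c ((x0 - x1) + x1) by rewrite subrK /x0 cdomK.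
  apply: main; last by rewrite (le_trans (ltW x01)).
  move=> s s1; rewrite -ball_normE/= opprD addrCA.
  rewrite (le_lt_trans (ler_normD _ _))// normrN [ltRHS]splitr ltrD//.
  exact: nr.
Qed.

(** Paths are not reversed here, so both directions are recorded. *)
Definition linked (r : R) p q := reach g r p q /\ reach g r q p.

Lemma linked_near p q r : linked r p q ->
  exists r', \forall q' \near q, linked r' p q'.
Proof.
move=> [pq qp]; have [K KP] := reach_near q.
exists (r + K); apply: filterS KP => q' [qq' q'q]; split.
  exact: reach_trans pq qq'.
by rewrite addrC; exact: reach_trans q'q qp.
Qed.

(** The set of points linked to p is open, and so is its complement. *)
Lemma linked_connected (hconn : connected [set: M]) p q : exists r, linked r p q.
Proof.
pose B := [set q | exists r, linked r p q].
suff BT : B = setT by suff : B q by []; rewrite BT.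
apply: hconn.
- by exists p, 0; split; exact: reach_refl.
- exists B; last by rewrite setTI.
  rewrite openE => q' [r pq']; have [r' r'P] := linked_near pq'.
  by apply: filterS r'P => q2 ?; exists r'.
- exists B; last by rewrite setTI.
  rewrite -openC openE => q' Bq'; have [K KP] := reach_near q'.
  apply: filterS KP => q2 [a b] [r [pq2 q2p]]; apply: Bq'; exists (r + K); split.
    exact: reach_trans pq2 b.
  by rewrite addrC; exact: reach_trans a q2p.
Qed.
End reach2.

(** The interiors of the balls of integer radius around a point cover M, so
finitely many of them cover A; a sum of the radii bounds all of them. *)
Lemma compact_rbounded (R : realType) (n : nat) (M : ptopologicalType)
    (S : smooth_manifold R n M) (g : riemannian_metric S) (A : set M) :
  connected [set: M] -> compact A -> rbounded g A.
Proof.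
move=> hconn; rewrite compact_cover => cA.
pose p : M := point.
pose f (k : nat) := interior [set q | linked g k%:R p q].
have [] := cA nat setT f.
- by move=> k _; exact: open_interior.
- move=> q _; have [r pq] := linked_connected g hconn p q.
  have [r' r'P] := linked_near pq.
  have [k kr] : exists k : nat, r' <= k%:R.
    by exists (Num.bound `|r'|); rewrite (le_trans (ler_norm _))// ltW// archi_boundP.
  exists k => //; apply: filterS r'P => q' [a b].
  by split; apply: reach_le kr _.
move=> D _ AD; pose s := finmap.enum_fset D.
exists ((\sum_(k <- s) k%:R) *+ 2) => a b Aa Ab.
have H q : A q -> linked g (\sum_(k <- s) k%:R) p q.
  move=> /AD[k kD] /interior_subset[pq qp].
  have kle : k%:R <= \sum_(k <- s) k%:R :> R.
    by rewrite (big_rem k)//= lerDl sumr_ge0.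
  by split; apply: reach_le kle _.
apply: reach_rdist; rewrite mulr2n.
exact: reach_trans (H a Aa).2 (H b Ab).1.
Qed.

(** * Measurability on a manifold *)

Lemma countable_bigcup_measurable d (T : measurableType d) (I : Type) (N : set I)
    (F : I -> set T) : countable N -> (forall i, N i -> measurable (F i)) ->
  measurable (\bigcup_(i in N) F i).
Proof.
move=> /countable_injP[f finj] mF.
have -> : \bigcup_(i in N) F i =
    \bigcup_(k : nat) \bigcup_(i in N `&` [set i | f i = k]) F i.
  apply/seteqP; split=> [x [i Ni Fx]|x [k _ [i [Ni _] Fx]]]; last by exists i.
  by exists (f i) => //; exists i.
apply: bigcupT_measurable => k.
have [[i [Ni fi]]|noi] := pselect (exists i, N i /\ f i = k); last first.
  rewrite (_ : \bigcup_(i in _) _ = set0) //.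
  by apply/seteqP; split=> // x [i [Ni fi] _]; case: noi; exists i.
rewrite (_ : \bigcup_(i in _) _ = F i); first exact: mF.
apply/seteqP; split=> [x [j [Nj fj] Fx]|x Fx]; last by exists i.
by rewrite (finj i j) ?inE// fi fj.
Qed.

Section measurable_algebra.
Context d (T : measurableType d) (R : realType) (D : set T).

Lemma measurable_fun_inv (f : T -> R) :
  measurable_fun D f -> measurable_fun D (fun x => (f x)^-1).
Proof.
move=> mf.
(* The square makes the base nonnegative, where real powers give inverses. *)
have -> : (fun x => (f x)^-1) = (fun x => f x * (f x ^+ 2) `^ (-1)).
  apply/funext => x; rewrite powR_inv1 ?sqr_ge0//.
  by have [->|f0] := eqVneq (f x) 0; rewrite ?invr0 ?mul0r// expr2 invfM mulVKf.
apply: measurable_funM => //.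
apply: (@measurableT_comp _ _ _ _ _ _ (fun y : R => y `^ (-1)) D
  (fun x => f x ^+ 2)); first exact: measurable_powR.
exact: measurable_funX.
Qed.

Lemma measurable_fun_sqrt (f : T -> R) :
  measurable_fun D f -> measurable_fun D (fun x => Num.sqrt (f x)).
Proof.
move=> mf; apply: measurableT_comp mf.
by apply: continuous_measurable_fun => x; exact: sqrt_continuous.
Qed.

Lemma measurable_det (n : nat) (A : T -> 'M[R]_n) :
  (forall i j, measurable_fun D (fun x => A x i j)) ->
  measurable_fun D (fun x => \det (A x)).
Proof.
move=> mA; apply: measurable_sum => s; apply: measurable_funM => //.
by apply: measurable_prod => i _; exact: mA.
Qed.

Lemma measurable_invmx (n : nat) (A : T -> 'M[R]_n) :
  (forall x, D x -> A x \in unitmx) ->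
  (forall i j, measurable_fun D (fun x => A x i j)) ->
  forall i j, measurable_fun D (fun x => invmx (A x) i j).
Proof.
move=> Au mA i j.
apply: (eq_measurable_fun (fun x => (\det (A x))^-1 * cofactor (A x) j i)).
  by move=> x /set_mem /Au Ax; rewrite /invmx Ax !mxE.
apply: measurable_funM; first exact/measurable_fun_inv/measurable_det.
rewrite /cofactor; apply: measurable_funM => //; apply: measurable_det => k l.
apply: (eq_measurable_fun (fun x => A x (lift j k) (lift i l))) => [x _|].
  by rewrite !mxE.
exact: mA.
Qed.

Lemma measurable_mulmx (m n p : nat) (A : T -> 'M[R]_(m, n)) (B : T -> 'M[R]_(n, p)) :
  (forall i j, measurable_fun D (fun x => A x i j)) ->
  (forall i j, measurable_fun D (fun x => B x i j)) ->
  forall i j, measurable_fun D (fun x => (A x *m B x) i j).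
Proof.
move=> mA mB i j.
apply: (eq_measurable_fun (fun x => \sum_k A x i k * B x k j)) => [x _|].
  by rewrite mxE.
by apply: measurable_sum => k; exact: measurable_funM.
Qed.

End measurable_algebra.

Section borel.
Context (R : realType) (M : ptopologicalType).
Local Notation B := (borelType M).

Lemma borel_open (U : set M) : open U -> measurable (U : set B).
Proof. by move=> oU; exact: sub_sigma_algebra. Qed.

Lemma borel_continuous_on (U : set M) (f : M -> R) : open U ->
  (forall p, U p -> {for p, continuous f}) -> measurable_fun (U : set B) (f : B -> R).
Proof.
move=> oU fc; apply: (measurability _ (RGenOInfty.measurableE R)) => _ [_ [x ->] <-].
apply: borel_open; rewrite openE => p [Up fp].
apply: (filterI (open_nbhs_nbhs (conj oU Up))).
apply: (fc p Up); apply: open_nbhs_nbhs; split => //.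
Qed.

End borel.

Section manifold_measurable.
Context (R : realType) (n : nat) (M : ptopologicalType)
        (S : smooth_manifold R n M) (g : riemannian_metric S).
Local Notation B := (borelType M).

(** A second countable manifold is covered by countably many chart domains, so
Borel measurability may be checked in each chart. *)
Lemma measurable_fun_charts (f : M -> R) :
  (forall c, atlas S c -> measurable_fun (cdom c : set B) (f : B -> R)) ->
  measurable_fun [set: B] (f : B -> R).
Proof.
move=> mf _ Y mY; rewrite setTI.
have [Bs cBs [oBs BsP]] := manifold_second_countable S.
pose N : set (set M) := [set b | Bs b /\ exists p, b `<=` cdom (chart_at S p)].
have cN : countable N by apply: sub_countable cBs; apply: subset_card_le => b [].
have -> : f @^-1` Y = \bigcup_(b in N) (b `&` f @^-1` Y).
  apply/seteqP; split=> [p fp|p [b _ []]//].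
  have /BsP[b [/= Bb bp] bc] := nbhs_cdom (chart_at_dom S p).
  by exists b; [split=> //; exists p|].
apply: countable_bigcup_measurable cN _ => b [Bb [p bp]].
have -> : b `&` f @^-1` Y = b `&` (cdom (chart_at S p) `&` f @^-1` Y).
  by rewrite setIA (setIidl bp).
apply: measurableI; first exact: (borel_open (oBs _ Bb)).
apply: mf => //; first exact: chart_at_atlas.
exact: (borel_open (cdom_open _)).
Qed.

Lemma measurable_fun_chart (c : chart R n M) (h : 'rV[R]_n -> R) :
  {in cimg c, continuous h} ->
  measurable_fun (cdom c : set B) (fun p : B => h (cfun c p)).
Proof.
move=> hc; apply: borel_continuous_on; first exact: cdom_open.
move=> p cp; apply: (@continuous_comp M 'rV[R]_n R (cfun c) h).
  exact: cvg_cfun.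
exact/hc/mem_set/cfun_img.
Qed.

Lemma measurable_form_in_chart (c : chart R n M) i j : atlas S c ->
  measurable_fun (cdom c : set B)
    (fun p : B => form_in_chart S (metric g) c p i j).
Proof.
move=> Sc; have [Gc _] := metric_smooth g Sc i j 0%N.
apply: eq_measurable_fun (measurable_fun_chart Gc) => p /set_mem cp.
by rewrite cdomK.
Qed.

Lemma measurable_smooth_fun u : smooth_fun S u -> measurable_fun [set: B] (u : B -> R).
Proof.
move=> su; apply: borel_continuous_on; first exact: openT.
by move=> p _; exact (smooth_fun_continuous su (x := p)).
Qed.

Lemma measurable_gradient u : smooth_fun S u -> measurable_field S (gradient g u).
Proof.
move=> su c Sc i.
apply: (eq_measurable_fun (fun p : B =>
   (chart_differential c u p *m invmx (form_in_chart S (metric g) c p)) 0 i)).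
  by move=> p /set_mem cp; rewrite gradient_in_chart.
apply: measurable_mulmx => k l.
  apply: (eq_measurable_fun (fun p : B => 'D_(delta_mx 0 l) (u \o cinv c) (cfun c p))).
    by move=> p _; rewrite ord1 mxE.
  have [_ /(_ l)[_ [uc _]]] := su c Sc 1%N.
  exact (measurable_fun_chart uc).
apply: measurable_invmx => [p cp|i' j']; last exact: measurable_form_in_chart.
exact: form_in_chart_unit.
Qed.

Lemma measurable_gnorm X : measurable_field S X ->
  measurable_fun [set: B] (fun p : B => gnorm g p (X p)).
Proof.
move=> mX; apply: measurable_fun_charts => c Sc.
pose w p := X p *m coord_change (chart_at S p) c p.
apply: (eq_measurable_fun (fun p : B => Num.sqrt
   ((w p *m form_in_chart S (metric g) c p *m (w p)^T) 0 0))).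
  by move=> p /set_mem cp; rewrite (gnorm_in_chart g _ Sc cp).
apply: measurable_fun_sqrt; apply: measurable_mulmx => k l.
  apply: measurable_mulmx => i j; last exact: measurable_form_in_chart.
  by rewrite ord1; exact: mX.
apply: (eq_measurable_fun (fun p : B => w p 0 k)); last exact: mX.
by move=> p _; rewrite (ord1 l) [RHS]mxE.
Qed.

Lemma measurable_fieldB X Y : measurable_field S X -> measurable_field S Y ->
  measurable_field S (fun p => X p - Y p).
Proof.
move=> mX mY c Sc i; apply: (eq_measurable_fun (fun p : B =>
   (X p *m coord_change (chart_at S p) c p) 0 i -
   (Y p *m coord_change (chart_at S p) c p) 0 i)).
  by move=> p _; rewrite mulmxBl !mxE.
exact: measurable_funB (mX c Sc i) (mY c Sc i).
Qed.

End manifold_measurable.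

(** * A smooth truncation of the absolute value *)

Section smooth_real.
Context (R : realType).

(** The derivatives of all orders are given as one family, which is the form in
which [Ck_on_comp] takes them. *)
Definition smooth_real (h : R -> R) : Prop :=
  exists2 H : nat -> R -> R, H 0%N = h &
    forall j (t : R), is_derive t 1 (H j) (H j.+1 t).

Lemma is_derive_cst_mul (h : R -> R) (b t dh : R) : is_derive t 1 h dh ->
  is_derive t 1 (fun t => b * h t) (b * dh).
Proof. by move=> hd; exact: (@is_deriveZ _ _ _ h b t 1 dh hd). Qed.

Lemma is_derive_comp_mul (h : R -> R) (a t dh : R) : is_derive (a * t) 1 h dh ->
  is_derive t 1 (fun t => h (a * t)) (a * dh).
Proof.
move=> hd; rewrite mulrC.
apply: (@is_derive1_comp _ h (fun t => a * t) t dh a hd).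
by rewrite -[a in X in is_derive _ _ _ X]mulr1; exact: is_derive_cst_mul.
Qed.

Lemma smooth_real_scale (h : R -> R) (a b : R) : smooth_real h ->
  smooth_real (fun t => b * h (a * t)).
Proof.
move=> [H <- HP]; exists (fun j t => b * (a ^+ j * H j (a * t))).
  by apply/funext => t; rewrite expr0 mul1r.
move=> j t; rewrite exprSr -(mulrA _ a).
apply: is_derive_cst_mul; apply: is_derive_cst_mul; apply: is_derive_comp_mul.
Qed.

Lemma smooth_realD (h k : R -> R) : smooth_real h -> smooth_real k ->
  smooth_real (fun t => h t + k t).
Proof.
move=> [H <- HP] [K <- KP]; exists (fun j t => H j t + K j t) => // j t.
exact: (is_deriveD (HP j t) (KP j t)).
Qed.

End smooth_real.

Section flat.
Context (R : realType).
Implicit Types (P : {poly R}) (s t x : R).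

(** P(1/s) e^(-1/s) for s > 0, extended by 0.  As P varies this family is closed
under derivation, also at the origin. *)
Definition flat P s := if 0 < s then P.[s^-1] * expR (- s^-1) else 0.

(** Since e^x >= x^(i+1) / (i+1)!, every monomial x^i e^(-x) is at most
(i+1)! / x. *)
Lemma poly_expR_le P : exists C : R, 0 <= C /\
  forall x, 0 < x -> `|P.[x]| * expR (- x) <= C / x.
Proof.
exists (\sum_(i < size P) `|P`_i| * (i.+1)`!%:R); split.
  by apply: sumr_ge0 => i _; rewrite mulr_ge0.
move=> x x0; rewrite horner_coef.
apply: le_trans (ler_wpM2r (expR_ge0 _) (ler_norm_sum _ _ _)) _.
rewrite !mulr_suml; apply: ler_sum => i _.
rewrite normrM -!mulrA ler_wpM2l// ger0_norm ?exprn_ge0 ?(ltW x0)//.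
rewrite expRN ler_pdivrMr ?expR_gt0// mulrAC ler_pdivlMr// -exprSr.
have f0 : 0 < (i.+1)`!%:R :> R by rewrite ltr0n fact_gt0.
rewrite mulrC -ler_pdivrMr//.
have := expR_ge1Dxn i (ltW x0); lra.
Qed.

Lemma is_derive_quadratic0 (f : R -> R) (C : R) : f 0 = 0 ->
  (forall h, `|f h| <= C * h ^+ 2) -> is_derive (0 : R) 1 f 0.
Proof.
move=> f0 fC.
have C0 : 0 <= C by have := fC 1; rewrite expr1n mulr1; apply: le_trans.
have L : (fun h => h^-1 *: ((f \o shift 0) (h *: 1) - f 0)) @ 0^' --> (0 : R).
  apply/cvgrPdist_le => e e0; near=> h.
  rewrite sub0r normrN f0 subr0 /= addr0 [h *: 1]mulr1 normrM normfV.
  have h0 : h != 0 by near: h; exact: nbhs_dnbhs_neq.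
  rewrite mulrC ler_pdivrMr ?normr_gt0//; apply: le_trans (fC h) _.
  rewrite -real_normK ?num_real// expr2 mulrA ler_wpM2r//.
  have he : `|h| <= e / (C + 1).
    by near: h; apply: dnbhs0_le; rewrite divr_gt0 ?ltr_wpDl.
  apply: le_trans (_ : C * (e / (C + 1)) <= _); first by rewrite ler_wpM2l.
  by rewrite mulrCA ler_piMr ?(ltW e0)// ler_pdivrMr ?ltr_wpDl// mul1r lerDl.
by apply: DeriveDef; [apply/cvg_ex; exists 0|exact: cvg_lim].
Unshelve. all: by end_near. Qed.

Lemma is_derive_flat P s :
  is_derive s 1 (flat P) (flat ('X^2 * (P - P^`())) s).
Proof.
have [s0|s0|->] := ltgtP s 0.
- rewrite {2}/flat ltNge (ltW s0)/=.
  apply: near_eq_is_derive (is_derive_cst (0 : R) s 1).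
  by near=> t; rewrite /flat ltNge ltW//; near: t; exact: lt_nbhsl.
- rewrite {2}/flat s0.
  have sn0 : s != 0 by rewrite gt_eqF.
  have dV : is_derive s 1 (fun t : R => t^-1) (- s ^- 2).
    apply: DeriveDef; first exact: derivableV.
    by rewrite deriveV// derive_id [_ *: 1]mulr1.
  have dE : is_derive s 1 (fun t : R => P.[t^-1] * expR (- t^-1))
      (('X^2 * (P - P^`())).[s^-1] * expR (- s^-1)).
    have dP : is_derive s 1 (fun t : R => P.[t^-1]) (P^`().[s^-1] * - s ^- 2).
      have dh : is_derive s^-1 1 (horner P) P^`().[s^-1].
        apply: DeriveDef; first exact: derivable_horner.
        by have /(congr1 (@^~ s^-1)) := derivE P; rewrite derive1E.
      exact: (@is_derive1_comp _ (horner P) (fun t => t^-1) s _ _ dh dV).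
    have de : is_derive s 1 (fun t : R => expR (- t^-1)) (expR (- s^-1) * s ^- 2).
      have dN : is_derive s 1 (fun t : R => - t^-1) (- - s ^- 2).
        exact: (is_deriveN dV).
      rewrite -[s ^- 2 in X in is_derive _ _ _ X]opprK.
      exact: (@is_derive1_comp _ expR (fun t => - t^-1) s _ _ (is_derive_expR _) dN).
    apply: (is_derive_eq (is_deriveM dP de)).
    have scaleE (a b : R) : a *: b = a * b := erefl.
    rewrite !scaleE hornerM hornerXn hornerD hornerN exprVn; ring.
  apply: near_eq_is_derive dE.
  by near=> t; rewrite /flat ifT//; near: t; exact: lt_nbhsr.
- rewrite {2}/flat ltxx.
  have [C [C0 CP]] := poly_expR_le ('X * P).
  apply: (@is_derive_quadratic0 _ C); first by rewrite /flat ltxx.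
  move=> h; rewrite /flat; case: ifP => [h0|_]; last first.
    by rewrite normr0 mulr_ge0 ?sqr_ge0.
  have hV : 0 < h^-1 by rewrite invr_gt0.
  have := CP _ hV; rewrite hornerM hornerX normrM invrK (ger0_norm (ltW hV)) -mulrA.
  rewrite ler_pdivrMl// => H.
  by rewrite normrM (ger0_norm (expR_ge0 _)) expr2 mulrCA (le_trans H)// mulrC.
Unshelve. all: by end_near. Qed.

(** With s = t - 1 this is s e^(-1/s) for s > 0, extended by 0.  Its derivative
(1 + 1/s) e^(-1/s) is at most 1 because 1 + x <= e^x, and for the same reason
s e^(-1/s) >= s - 1. *)
Definition soft t := (t - 1) * flat 1 (t - 1).
Definition dsoft t := flat (1 + 'X) (t - 1).

Lemma is_derive_shift1 (f : R -> R) t d : is_derive (t - 1) 1 f d ->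
  is_derive t 1 (fun t => f (t - 1)) d.
Proof.
move=> fd; rewrite -[d]mulr1.
have ds : is_derive t 1 (fun t : R => t - 1) 1.
  apply: (is_derive_eq (is_deriveB (is_derive_id t 1) (is_derive_cst (1 : R) t 1))).
  by rewrite subr0.
exact: (@is_derive1_comp _ f (fun t => t - 1) t _ _ fd ds).
Qed.

Lemma is_derive_soft t : is_derive t 1 soft (dsoft t).
Proof.
apply: is_derive_shift1 (fun s => s * flat 1 s) _ _ _.
apply: (is_derive_eq (is_deriveM (is_derive_id (t - 1) 1) (is_derive_flat 1 (t - 1)))).
have scaleE (a b : R) : a *: b = a * b := erefl.
rewrite !scaleE mulr1 /dsoft /flat; case: ifP => [s0|_]; last by rewrite mulr0 addr0.
rewrite derivC subr0 mulr1 hornerXn hornerD hornerX hornerC mul1r.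
by field; rewrite gt_eqF.
Qed.

Lemma smooth_soft : smooth_real soft.
Proof.
pose P k := iter k (fun Q : {poly R} => 'X^2 * (Q - Q^`())) (1 + 'X).
exists (fun j => if j is j'.+1 then fun t => flat (P j') (t - 1) else soft) => //.
case=> [|j] t; first exact: is_derive_soft.
by rewrite /P iterS; exact: is_derive_shift1 (is_derive_flat (P j) (t - 1)).
Qed.

Lemma soft_eq0 t : t <= 1 -> soft t = 0.
Proof. by move=> t1; rewrite /soft /flat subr_gt0 ltNge t1 mulr0. Qed.

Lemma soft_ge0 t : 0 <= soft t.
Proof.
have [t1|t1] := leP t 1; first by rewrite soft_eq0.
by rewrite mulr_ge0 ?subr_ge0 ?(ltW t1)// /flat subr_gt0 t1 hornerC mul1r expR_ge0.
Qed.

Lemma soft_ge t : t - 2 <= soft t.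
Proof.
have [t1|t1] := leP t 1; first by rewrite soft_eq0//; lra.
have s0 : 0 < t - 1 by rewrite subr_gt0.
rewrite /soft /flat s0 hornerC mul1r.
have := expR_ge1Dx (- (t - 1)^-1) => /(ler_wpM2l (ltW s0)).
apply: le_trans; rewrite mulrDr mulr1 mulrN divff ?gt_eqF//; lra.
Qed.

Lemma dsoft_ge0_le1 t : 0 <= dsoft t <= 1.
Proof.
rewrite /dsoft /flat; case: ifP => [s0|_]; last by rewrite lexx ler01.
have V0 : 0 < (t - 1)^-1 by rewrite invr_gt0.
rewrite hornerD hornerX hornerC mulr_ge0 ?expR_ge0 ?addr_ge0 ?(ltW V0)//=.
by rewrite expRN ler_pdivrMr ?expR_gt0// mul1r expR_ge1Dx.
Qed.

(** The even version of [soft], a smooth truncation of the absolute value. *)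
Definition softabs t := soft t + soft (- t).
Definition dsoftabs t := dsoft t - dsoft (- t).

Lemma is_derive_softabs t : is_derive t 1 softabs (dsoftabs t).
Proof.
apply: is_deriveD; first exact: is_derive_soft.
rewrite -mulN1r; have -> : (fun t => soft (- t)) = (fun t => soft (-1 * t)).
  by apply/funext => s; rewrite mulN1r.
apply: is_derive_comp_mul; rewrite mulN1r; exact: is_derive_soft.
Qed.

Lemma smooth_softabs : smooth_real softabs.
Proof.
apply: smooth_realD; first exact: smooth_soft.
have := smooth_real_scale (-1) 1 smooth_soft.
by congr smooth_real; apply/funext => t; rewrite mul1r mulN1r.
Qed.

Lemma softabs_eq0 t : `|t| <= 1 -> softabs t = 0.
Proof.
by rewrite ler_norml => /andP[t1 t2]; rewrite /softabs !soft_eq0 ?addr0//; lra.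
Qed.

Lemma softabs_ge0 t : 0 <= softabs t.
Proof. by rewrite addr_ge0 ?soft_ge0. Qed.

Lemma le_softabs t : `|t| <= softabs t + 2.
Proof.
have := soft_ge t; have := soft_ge (- t); have := soft_ge0 t; have := soft_ge0 (- t).
by rewrite /softabs; case: (ger0P t) => _; lra.
Qed.

Lemma dsoftabs_le1 t : `|dsoftabs t| <= 1.
Proof.
have /andP[a b] := dsoft_ge0_le1 t; have /andP[c d] := dsoft_ge0_le1 (- t).
by rewrite ler_norml /dsoftabs; apply/andP; split; lra.
Qed.

End flat.

(** * Real inequalities *)

Section exp_trunc.
Context (R : realType).
Implicit Types (t : R) (m : nat).

Let partial t N := \sum_(0 <= k < N) t ^+ k / k`!%:R.

Let partial_nd t : 0 <= t -> nondecreasing_seq (partial t).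
Proof.
move=> t0; apply/nondecreasing_seqP => N; rewrite /partial big_nat_recr//= lerDl.
by rewrite mulr_ge0// exprn_ge0.
Qed.

Let partial_le t N : 0 <= t -> partial t N <= expR t.
Proof.
move=> t0; rewrite /expR.
exact: (nondecreasing_cvgn_le (partial_nd t0) (is_cvg_series_exp_coeff t)).
Qed.

Lemma exp_trunc_ge0 m t : 0 <= t -> 0 <= exp_trunc m t.
Proof. by move=> t0; rewrite subr_ge0; exact: partial_le. Qed.

Lemma exp_trunc_le_expR m t : 0 <= t -> exp_trunc m t <= expR t.
Proof.
move=> t0; rewrite gerBl; apply: sumr_ge0 => k _.
by rewrite mulr_ge0// exprn_ge0.
Qed.

Lemma exp_trunc_le m t : 0 <= t -> exp_trunc m t <= t ^+ m.+1 * expR t.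
Proof.
move=> t0; rewrite lerBlDl.
(* In the tail, t^(m+1) factors out and k! >= (k - m - 1)!. *)
have H N : partial t N <= partial t m.+1 + t ^+ m.+1 * expR t.
  have [Nm|mN] := leqP N m.+1.
    apply: le_trans (partial_nd t0 Nm) _.
    by rewrite lerDl mulr_ge0 ?expR_ge0// exprn_ge0.
  rewrite /partial (big_cat_nat (leq0n m.+1) (ltnW mN))//= lerD2l -{1}[m.+1]add0n big_addn.
  apply: le_trans (ler_wpM2l _ (partial_le (N - m.+1) t0)); last exact: exprn_ge0.
  rewrite mulr_sumr; apply: ler_sum => k _.
  rewrite addnC exprD -mulrA ler_wpM2l ?exprn_ge0// ler_wpM2l ?exprn_ge0//.
  by rewrite lef_pV2 ?posrE ?ltr0n ?fact_gt0// ler_nat leq_fact// leq_addl.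
by rewrite {1}/expR; apply: limr_le; [exact: is_cvg_series_exp_coeff|exact: nearW].
Qed.

Lemma exp_trunc_continuous m : continuous (@exp_trunc R m).
Proof.
move=> t; rewrite /exp_trunc.
have -> : (fun t => expR t - \sum_(0 <= k < m.+1) t ^+ k / k`!%:R) =
   (fun t : R => expR t - \sum_(k < m.+1) t ^+ k / k`!%:R).
  by apply/funext => s; rewrite big_mkord.
have sc : {for t, continuous (fun t : R => \sum_(k < m.+1) t ^+ k / k`!%:R)}.
  apply: continuous_sum => k.
  exact (continuous_comp (@exprn_continuous _ k t) (@mulrr_continuous _ _ _)).
exact (continuousB (@continuous_expR _ t) sc).
Qed.

End exp_trunc.

Section powers.
Context (R : realType) (n : nat) (hn : (2 <= n)%N).
Implicit Types a b theta : R.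

(** The exponent n / (n - 1), the Hoelder conjugate of n. *)
Definition conj_exp : R := n%:R / n.-1%:R.

Let n1_gt0 : 0 < n.-1%:R :> R.
Proof. by rewrite ltr0n -ltnS prednK// ltnW. Qed.

Let n_gt0 : 0 < n%:R :> R.
Proof. by rewrite ltr0n ltnW. Qed.

Let nE : n%:R = n.-1%:R + 1 :> R.
Proof. by rewrite natr1 prednK// ltnW. Qed.

Lemma conj_exp_ge1 : 1 <= conj_exp.
Proof. by rewrite /conj_exp ler_pdivlMr// mul1r nE lerDl. Qed.

Lemma conj_expE : conj_exp = 1 + (n.-1%:R)^-1.
Proof. by rewrite /conj_exp nE mulrDl divff ?gt_eqF// mul1r. Qed.

Lemma powR_conj_exp a : 0 <= a -> a `^ conj_exp = (a ^+ n) `^ (n.-1%:R)^-1.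
Proof. by move=> a0; rewrite /conj_exp powRrM powR_mulrn. Qed.

Lemma powR_invnK a : 0 <= a -> (a `^ (n%:R)^-1) ^+ n = a.
Proof.
by move=> a0; rewrite -powR_mulrn ?powR_ge0// -powRrM mulVf ?powRr1// gt_eqF.
Qed.

(** Convexity of the power function, for a + b seen as the combination of
a / (1 - theta) and b / theta with weights 1 - theta and theta. *)
Lemma powR_add_le a b theta : 0 <= a -> 0 <= b -> 0 < theta < 1 ->
  (a + b) `^ conj_exp <=
  ((1 - theta)^-1 `^ (n%:R)^-1 * a) `^ conj_exp +
  (b ^+ n / theta) `^ (n.-1%:R)^-1.
Proof.
move=> a0 b0 /andP[t0 t1]; set q := conj_exp.
have t1' : 0 < 1 - theta by rewrite subr_gt0.
have weight c w : 0 <= c -> 0 < w ->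
    w * (c / w) `^ q = (c ^+ n / w) `^ (n.-1%:R)^-1.
  move=> c0 w0; rewrite powRM ?invr_ge0 ?(ltW w0)// mulrCA.
  rewrite powRM ?exprn_ge0 ?invr_ge0 ?(ltW w0)// -powR_conj_exp//; congr (_ * _).
  rewrite /q conj_expE powRD; last by rewrite invr_eq0 gt_eqF ?implybT.
  by rewrite powRr1 ?invr_ge0 ?(ltW w0)// mulrA divff ?mul1r ?gt_eqF.
have P : ((1 - theta)^-1 `^ (n%:R)^-1 * a) `^ q =
    (a ^+ n / (1 - theta)) `^ (n.-1%:R)^-1.
  rewrite powR_conj_exp ?mulr_ge0 ?powR_ge0// exprMn powR_invnK ?invr_ge0 ?ltW//.
  by rewrite mulrC.
rewrite P -weight// -weight// (addrC a) [leRHS]addrC.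
have I01 : Itv.spec (@Itv.num_sem R) (Itv.Real `[0%Z, 1%Z]) theta.
  by rewrite /= /Itv.num_sem/= num_real/= in_itv/= !ltW.
have := @convex_powR R q conj_exp_ge1 (Itv.mk I01) (b / theta) (a / (1 - theta)).
rewrite !inE/= !in_itv/= !andbT => /(_ _ _) H.
have {}H : (theta * (b / theta) + (1 - theta) * (a / (1 - theta))) `^ q <=
    theta * (b / theta) `^ q + (1 - theta) * (a / (1 - theta)) `^ q.
  exact: H (divr_ge0 b0 (ltW t0)) (divr_ge0 a0 (ltW t1')).
have cancel (u w : R) : 0 < w -> w * (u / w) = u.
  by move=> w0; rewrite mulrC divfK ?gt_eqF.
by move: H; rewrite !cancel.
Qed.

End powers.

(** * Test functions *)

Section Lnorm_power.
Context d (T : measurableType d) (R : realType) (mu : {measure set T -> \bar R}).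
Local Open Scope ereal_scope.

Lemma poweR_mulrn (x : \bar R) (k : nat) : (0 < k)%N -> 0 <= x ->
  x `^ k%:R = x ^+ k.
Proof.
move=> k0; case: x => [r r0| _|//].
  by rewrite poweR_EFin powR_mulrn// EFin_expe.
rewrite poweRyr ?pnatr_eq0 -?lt0n//; case: k k0 => // k _.
by elim: k => // k IH; rewrite expeS -IH mulyy.
Qed.

Lemma Lnorm_expe (f : T -> R) (k : nat) : (0 < k)%N ->
  Lnorm mu k%:R%:E (EFin \o f) ^+ k = \int[mu]_x (`|f x| ^+ k)%:E.
Proof.
move=> k0; rewrite -poweR_mulrn ?Lnorm_ge0// poweR_Lnorm ?pnatr_eq0 -?lt0n//.
apply: eq_integral => x _.
by rewrite -[(EFin \o f) x]/(f x)%:E abse_EFin poweR_EFin powR_mulrn.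
Qed.

Lemma le_Lnorm (f h : T -> R) (k : nat) : (0 < k)%N ->
  (forall x, `|f x| <= `|h x|)%R ->
  Lnorm mu k%:R%:E (EFin \o f) <= Lnorm mu k%:R%:E (EFin \o h).
Proof.
move=> k0 fh; rewrite unlock/=.
apply: gt0_ler_poweR; rewrite ?invr_ge0 ?ler0n ?in_itv/= ?leey ?andbT//.
- by apply: integral_ge0 => x _; rewrite lee_fin powR_ge0.
- by apply: integral_ge0 => x _; rewrite lee_fin powR_ge0.
apply: ge0_le_integral_any => x _; first by rewrite lee_fin powR_ge0.
by rewrite lee_fin ge0_ler_powR ?nnegrE.
Qed.

End Lnorm_power.

Section test_functions.
Context (R : realType) (n : nat) (M : ptopologicalType)
        (S : smooth_manifold R n M) (g : riemannian_metric S).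
Implicit Types (u : M -> R) (h : R -> R).

Lemma smooth_fun_comp h u : smooth_real h -> smooth_fun S u -> smooth_fun S (h \o u).
Proof.
move=> [H <- HP] su c Sc k.
exact (Ck_on_comp HP 0 (@cimg_open _ _ _ c) (su c Sc k)).
Qed.

Lemma test_function_comp h u : smooth_real h -> h 0 = 0 ->
  test_function S u -> test_function S (h \o u).
Proof.
move=> sh h0 [su cu]; split; first exact: smooth_fun_comp.
apply: (subclosed_compact _ cu); first exact: closed_closure.
apply: closureS => p /=.
by apply: contra_neq => up; rewrite up h0.
Qed.

Lemma gradient_comp h u p dh : smooth_fun S u -> is_derive (u p) 1 h dh ->
  gradient g (h \o u) p = dh *: gradient g u p.
Proof.
move=> su hd; pose c := chart_at S p.
have Sc : atlas S c := chart_at_atlas S p.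
have cp : cdom c p := chart_at_dom S p.
have du := smooth_fun_differentiable su Sc cp.
rewrite /gradient scalemxAl; congr (_ *m _); apply/rowP => i; rewrite !mxE.
have ud := derivableP (diff_derivable (v := delta_mx 0 i) du).
have hd' : is_derive ((u \o cinv c) (cfun c p)) 1 h dh by rewrite /= cdomK.
by have [_ ->] := is_derive_comp_dir hd' ud.
Qed.

Lemma smooth_real_mul (a : R) : smooth_real ( *%R a).
Proof.
have : smooth_real (@id R).
  exists (fun j t => if j is j'.+1 then (j' == 0%N)%:R else t) => //.
  by case=> [|j] t; [exact: is_derive_id|exact: is_derive_cst].
move=> /(smooth_real_scale 1 a); congr smooth_real; apply/funext => t.
by rewrite mul1r.
Qed.

Lemma is_derive_mul (a t : R) : is_derive t 1 ( *%R a) a.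
Proof.
by rewrite -[a in X in is_derive _ _ _ X]mulr1; exact: is_derive_cst_mul.
Qed.

End test_functions.

(** * The inequality for test functions *)

Lemma expe_le1 (R : realType) (x : \bar R) (k : nat) : (0 < k)%N ->
  (0 <= x)%E -> (x ^+ k <= 1)%E -> (x <= 1)%E.
Proof.
case: k => // k _; case: x => [x|_|//].
  by rewrite -EFin_expe !lee_fin => x0; rewrite expr_le1.
have -> : (+oo ^+ k.+1 = +oo :> \bar R)%E by elim: k => // k IH; rewrite expeS IH mulyy.
by [].
Qed.

Lemma rbounded_subset (R : realType) (n : nat) (M : topologicalType)
    (S : smooth_manifold R n M) (g : riemannian_metric S) (A B : set M) :
  A `<=` B -> rbounded g B -> rbounded g A.
Proof. by move=> AB [r rB]; exists r => p q /AB Bp /AB Bq; exact: rB. Qed.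

Lemma MTconst_ge0 (R : realType) (n : nat) : 0 <= MTconst R n.
Proof. by rewrite mulr_ge0 ?powR_ge0. Qed.

Section core.
Context (R : realType) (n : nat) (hn : (2 <= n)%N) (M : ptopologicalType)
        (S : smooth_manifold R n M) (hconn : connected [set: M])
        (g : riemannian_metric S)
        (mu : {measure set (borelType M) -> \bar R}).
Local Notation B := (borelType M).
Local Notation q := (conj_exp R n).
Local Notation gamma := (MTconst R n).

Let n0 : (0 < n)%N. Proof. exact: ltnW. Qed.

Lemma fun_normX (u : M -> R) :
  (fun_norm n mu u ^+ n = \int[mu]_p (`|u p| ^+ n)%:E)%E.
Proof. exact: (Lnorm_expe mu u n0). Qed.

Lemma field_normX (X : M -> 'rV[R]_n) :
  (field_norm g mu X ^+ n = \int[mu]_p (gnorm g p (X p) ^+ n)%:E)%E.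
Proof.
rewrite /field_norm (Lnorm_expe mu (fun p : B => gnorm g p (X p)) n0).
by apply: eq_integral => p _; rewrite ger0_norm ?gnorm_ge0.
Qed.

Lemma fun_norm_ge0 (u : M -> R) : (0 <= fun_norm n mu u)%E.
Proof. exact: Lnorm_ge0. Qed.

Lemma field_norm_ge0 (X : M -> 'rV[R]_n) : (0 <= field_norm g mu X)%E.
Proof. exact: Lnorm_ge0. Qed.

(** The constant sequence f converges to f. *)
Lemma test_function_W0 f : test_function S f -> W0 g mu f (gradient g f).
Proof.
move=> tf; have [sf _] := tf; split.
- exact: measurable_smooth_fun sf.
- exact: measurable_gradient.
exists (fun=> f); split => //.
- rewrite (_ : fun_norm n mu _ = 0%E); first exact: cvg_cst.
  rewrite /fun_norm -(@Lnorm0 _ _ _ mu n%:R%:E) ?eqe ?pnatr_eq0 -?lt0n//.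
  by congr Lnorm; apply/funext => p; rewrite subrr.
- rewrite (_ : field_norm g mu _ = 0%E); first exact: cvg_cst.
  rewrite /field_norm -(@Lnorm0 _ _ _ mu n%:R%:E) ?eqe ?pnatr_eq0 -?lt0n//.
  by congr Lnorm; apply/funext => p; rewrite subrr gnorm0.
Qed.

Lemma measurable_powR_norm (u : M -> R) (r : R) :
  measurable_fun [set: B] (u : B -> R) ->
  measurable_fun [set: B] (fun p : B => `|u p| `^ r).
Proof.
move=> meas_u; apply: (@measurableT_comp _ _ _ _ _ _ (fun y : R => y `^ r) _
  (fun p : B => `|u p|)); first exact: measurable_powR.
exact: (measurableT_comp (@normr_measurable _ _) meas_u).
Qed.

Lemma measurable_exp_trunc (u : M -> R) (m : nat) :
  measurable_fun [set: B] (u : B -> R) ->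
  measurable_fun [set: B] (fun p : B => (exp_trunc m (gamma * `|u p| `^ q))%:E).
Proof.
move=> meas_u; apply/measurable_EFinP; apply: (@measurableT_comp _ _ _ _ _ _
  (@exp_trunc R m) _ (fun p : B => gamma * `|u p| `^ q)).
  by apply: continuous_measurable_fun => t; exact: exp_trunc_continuous.
by apply: measurable_funM => //; exact: measurable_powR_norm.
Qed.

Definition superlevel (f : M -> R) (A : R) : set B := [set p | A < `|f p|].

Lemma measurable_superlevel (f : M -> R) (A : R) :
  measurable_fun [set: B] (f : B -> R) -> measurable (superlevel f A).
Proof.
move=> mf; rewrite -[X in measurable X]setTI.
have -> : superlevel f A = (fun p : B => `|f p|) @^-1` `]A, +oo[%classic.
  by apply/seteqP; split=> p; rewrite /superlevel/= in_itv/= andbT.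
exact: (measurableT_comp (@normr_measurable _ _) mf).
Qed.

Lemma chebyshev_superlevel (f : M -> R) (A s : R) (m : nat) :
  measurable_fun [set: B] (f : B -> R) -> 0 < A ->
  (\int[mu]_p (`|f p| ^+ m)%:E <= s%:E)%E ->
  (mu (superlevel f A) <= (s / A ^+ m)%:E)%E.
Proof.
move=> mf A0 fs; set E := superlevel f A.
have mE : measurable E := measurable_superlevel A mf.
rewrite EFinM muleC lee_pdivlMl ?exprn_gt0//.
apply: le_trans fs.
rewrite -(integral_cst mu mE).
apply: (@le_trans _ _ (\int[mu]_(p in E) (`|f p| ^+ m)%:E)%E).
  apply: ge0_le_integral_any => p; first by rewrite lee_fin exprn_ge0 ?(ltW A0).
  by move=> Ep; rewrite lee_fin lerXn2r// ?nnegrE ltW.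
apply: ge0_subset_integral => //.
apply/measurable_EFinP/measurable_funX.
exact: (measurableT_comp (@normr_measurable _ _) mf).
Qed.

(** The first constant bounds the error term of [powR_add_le] on the superlevel
set, the second one bounds |f|^(n/(n-1)) outside of it. *)
Definition ruf_inner (tau kappa : R) : R :=
  (2 ^+ n.+1 / (tau * kappa)) `^ (n.-1%:R)^-1.
Definition ruf_outer (tau kappa : R) : R := ((tau * kappa)^-1) `^ (n.-1%:R)^-1.
Definition ruf_const (tau C0 kappa : R) : R :=
  expR (gamma * ruf_inner tau kappa) * C0 +
  gamma ^+ n.-1 * expR (gamma * ruf_outer tau kappa) / kappa.

Section one_function.
Context (f : M -> R) (tau kappa s : R).
Hypotheses (tf : test_function S f) (tau0 : 0 < tau) (kappa0 : 0 < kappa)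
  (s0 : 0 < s) (fs : (\int[mu]_p (`|f p| ^+ n)%:E <= s%:E)%E)
  (fks : (field_norm g mu (gradient g f) ^+ n + (kappa * s)%:E <= 1)%E).

(* The level A makes the superlevel set E of measure at most tau.  Half of
   kappa * s is used for theta to keep it below 1. *)
Let A := (s / tau) `^ (n%:R)^-1.
Let theta := kappa * s / 2.
Let lam := (1 - theta)^-1 `^ (n%:R)^-1.
Let w p := lam * A * softabs (A^-1 * f p).
Let E := superlevel f A.

Let ks1 : kappa * s <= 1.
Proof.
rewrite -lee_fin; apply: le_trans fks; rewrite leeDr//.
by rewrite field_normX integral_ge0// => p _; rewrite lee_fin exprn_ge0 ?gnorm_ge0.
Qed.

Let st0 : 0 < s / tau. Proof. exact: divr_gt0. Qed.
Let A0 : 0 < A. Proof. exact: powR_gt0. Qed.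
Let An : A ^+ n = s / tau. Proof. by rewrite powR_invnK ?ltW. Qed.
Let theta01 : 0 < theta < 1.
Proof.
have := ks1; have := mulr_gt0 kappa0 s0; rewrite /theta => H1 H2; apply/andP; split; lra.
Qed.
Let lamn : lam ^+ n = (1 - theta)^-1.
Proof. by have /andP[a b] := theta01; rewrite powR_invnK// invr_ge0 subr_ge0 ltW. Qed.
Let lam0 : 0 <= lam. Proof. exact: powR_ge0. Qed.

Let mf : measurable_fun [set: B] (f : B -> R).
Proof. by have [sf _] := tf; exact: measurable_smooth_fun sf. Qed.
Let mE : measurable E. Proof. exact: measurable_superlevel. Qed.

Let tw : test_function S w.
Proof.
apply: (@test_function_comp _ _ _ _ (fun t => lam * A * softabs (A^-1 * t))) => //.
  exact: smooth_real_scale (smooth_softabs R).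
by rewrite mulr0 softabs_eq0 ?normr0 ?mulr0.
Qed.

Let gradient_w p : gnorm g p (gradient g w p) <= lam * gnorm g p (gradient g f p).
Proof.
have [sf _] := tf.
have hd : is_derive (f p) 1 (fun t => lam * A * softabs (A^-1 * t))
    (lam * A * (A^-1 * dsoftabs (A^-1 * f p))).
  by apply: is_derive_cst_mul; apply: is_derive_comp_mul; exact: is_derive_softabs.
have := gradient_comp g sf hd; rewrite -/w => ->.
rewrite gnormZ ler_wpM2r ?gnorm_ge0//.
have -> : lam * A * (A^-1 * dsoftabs (A^-1 * f p)) = lam * dsoftabs (A^-1 * f p).
  by rewrite -mulrA (mulrA A) divff ?mul1r ?gt_eqF.
by rewrite normrM (ger0_norm lam0) ler_piMr// dsoftabs_le1.
Qed.

Let w_norm : (field_norm g mu (gradient g w) <= 1)%E.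
Proof.
apply: expe_le1 n0 (field_norm_ge0 _) _; rewrite field_normX.
have mgf : measurable_fun [set: B] (fun p : B => gnorm g p (gradient g f p)).
  by apply: measurable_gnorm; apply: measurable_gradient; case: tf.
apply: (@le_trans _ _ (\int[mu]_p ((lam ^+ n)%:E * (gnorm g p (gradient g f p) ^+ n)%:E))%E).
  apply: ge0_le_integral_any => p _; first by rewrite lee_fin exprn_ge0 ?gnorm_ge0.
  rewrite -EFinM lee_fin -exprMn lerXn2r// ?nnegrE ?gnorm_ge0//.
  by rewrite mulr_ge0 ?gnorm_ge0.
rewrite ge0_integralZl_EFin//; last 3 first.
- by move=> p _; rewrite lee_fin exprn_ge0 ?gnorm_ge0.
- exact/measurable_EFinP/measurable_funX.
- exact: exprn_ge0.
rewrite -field_normX lamn.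
have /andP[a b] := theta01.
rewrite lee_pdivrMl ?subr_gt0// mule1.
have : (field_norm g mu (gradient g f) ^+ n <= 1 - (kappa * s)%:E)%E.
  by rewrite leeBrDr.
move/le_trans; apply; rewrite -EFinB lee_fin lerD2l lerN2 /theta.
by rewrite ler_pdivrMr// ler_peMr ?ltW ?mulr_gt0// ltr1n.
Qed.

Let w_out p : ~ E p -> w p = 0.
Proof.
move=> /negP; rewrite -leNgt => fA; rewrite /w softabs_eq0 ?mulr0//.
by rewrite normrM normfV (gtr0_norm A0) ler_pdivrMl// mulr1.
Qed.

Let E_le : (mu E <= tau%:E)%E.
Proof.
apply: le_trans (chebyshev_superlevel mf A0 fs) _; rewrite An lee_fin invf_div.
by rewrite mulrCA divff ?gt_eqF// mulr1.
Qed.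

Let f_in p : gamma * `|f p| `^ q <= gamma * `|w p| `^ q + gamma * ruf_inner tau kappa.
Proof.
rewrite -mulrDr ler_wpM2l ?MTconst_ge0//.
set a := A * softabs (A^-1 * f p).
have a0 : 0 <= a by rewrite mulr_ge0 ?softabs_ge0 ?ltW.
have fa : `|f p| <= a + 2 * A.
  have := le_softabs (A^-1 * f p); rewrite normrM normfV (gtr0_norm A0).
  by rewrite ler_pdivrMl// mulrDr [A * 2]mulrC.
have q0 : 0 <= q := le_trans ler01 (conj_exp_ge1 R hn).
apply: le_trans (ge0_ler_powR q0 _ _ fa) _.
- by rewrite nnegrE.
- by rewrite nnegrE (le_trans _ fa).
have -> : `|w p| = lam * a by rewrite ger0_norm /w -mulrA// mulr_ge0.
have A20 : 0 <= 2 * A by rewrite mulr_ge0 ?ltW.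
apply: le_trans (powR_add_le hn a0 A20 theta01) _; rewrite lerD2l.
rewrite exprMn An /theta /ruf_inner le_eqVlt; apply/orP; left; apply/eqP.
congr (_ `^ _); rewrite exprS; field.
by rewrite !gt_eqF.
Qed.

Let f_out p : ~ E p ->
  exp_trunc (n - 2) (gamma * `|f p| `^ q) <=
  gamma ^+ n.-1 * expR (gamma * ruf_outer tau kappa) * `|f p| ^+ n.
Proof.
move=> /negP; rewrite -leNgt => fA.
have n1 : n.-1%:R != 0 :> R by rewrite pnatr_eq0 -lt0n -ltnS prednK.
have t0 : 0 <= gamma * `|f p| `^ q by rewrite mulr_ge0 ?MTconst_ge0 ?powR_ge0.
apply: le_trans (exp_trunc_le _ t0) _.
have -> : (n - 2).+1 = n.-1 by rewrite subn2 prednK// -ltnS prednK.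
have -> : (gamma * `|f p| `^ q) ^+ n.-1 = gamma ^+ n.-1 * `|f p| ^+ n.
  rewrite exprMn; congr (_ * _); rewrite powR_conj_exp//.
  by rewrite -[LHS]powR_mulrn ?powR_ge0// -powRrM mulVf// powRr1// exprn_ge0.
rewrite mulrAC; apply: ler_wpM2r; first exact: exprn_ge0.
apply: ler_wpM2l; first exact/exprn_ge0/MTconst_ge0.
rewrite ler_expR; apply: ler_wpM2l; first exact: MTconst_ge0.
rewrite powR_conj_exp//.
apply: ge0_ler_powR; rewrite ?nnegrE ?exprn_ge0 ?invr_ge0 ?mulr_ge0 ?(ltW tau0) ?(ltW kappa0)//.
apply: (@le_trans _ _ (A ^+ n)); first by rewrite lerXn2r// ?nnegrE ?(ltW A0).
rewrite An ler_pdivrMr// invfM mulrAC mulVf ?mul1r ?gt_eqF//.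
by rewrite -[leRHS]mulr1 ler_pdivlMl.
Qed.

Let measurable_fnorm : measurable_fun [set: B] (fun p : B => (`|f p| ^+ n)%:E).
Proof.
apply/measurable_EFinP/measurable_funX.
exact: (measurableT_comp (@normr_measurable _ _) mf).
Qed.

(** On E the exponential of [f_in] turns the error term into a constant factor;
off E the bound [f_out] is integrated over the whole manifold. *)
Lemma ruf_one (C0 : R) :
  (forall E' : set B, measurable E' -> rbounded g E' -> (mu E' <= tau%:E)%E ->
    forall (u : M -> R) (X : M -> 'rV[R]_n), W0 g mu u X ->
      (field_norm g mu X <= 1)%E -> {ae mu, forall p, ~ E' p -> u p = 0} ->
      (\int[mu]_(p in E') (expR (gamma * `|u p| `^ (n%:R / n.-1%:R)))%:E <= C0%:E)%E) ->
  (\int[mu]_p (exp_trunc (n - 2) (gamma * `|f p| `^ q))%:E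
    <= (ruf_const tau C0 kappa)%:E)%E.
Proof.
move=> LMT.
have mphi := measurable_exp_trunc (n - 2) mf.
have phi0 p : (0%:E <= (exp_trunc (n - 2) (gamma * `|f p| `^ q))%:E)%E.
  by rewrite lee_fin exp_trunc_ge0// mulr_ge0 ?MTconst_ge0 ?powR_ge0.
have mEC : measurable (~` E) by exact: measurableC.
have -> : [set: B] = E `|` ~` E by rewrite setUv.
rewrite ge0_integral_setU//; last 2 first.
- by rewrite setUv.
- by rewrite disj_set2E setICr.
rewrite /ruf_const EFinD leeD//.
- apply: (@le_trans _ _ (\int[mu]_(p in E) ((expR (gamma * ruf_inner tau kappa))%:E *
     (expR (gamma * `|w p| `^ q))%:E))%E).
    apply: ge0_le_integral_any => p _; first exact: phi0.
    rewrite -EFinM lee_fin -expRD addrC.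
    apply: le_trans (exp_trunc_le_expR _ _) _.
      by rewrite mulr_ge0 ?MTconst_ge0 ?powR_ge0.
    by rewrite ler_expR f_in.
  rewrite ge0_integralZl_EFin ?expR_ge0//; last first.
    apply/measurable_EFinP/(measurableT_comp (@measurable_expR _)).
    apply: measurable_funM => //; apply: measurable_funTS.
    by have [sw _] := tw; exact: measurable_powR_norm (measurable_smooth_fun sw).
  rewrite EFinM lee_wpmul2l ?lee_fin ?expR_ge0//.
  apply: (LMT E mE _ E_le w _ (test_function_W0 tw) w_norm).
    apply: rbounded_subset (compact_rbounded g hconn (proj2 tf)).
    move=> p; rewrite /E /superlevel/= => Ap; apply: subset_closure => /=.
    by rewrite -normr_gt0 (lt_trans A0).
  by apply: nearW => p; exact: w_out.
- apply: (@le_trans _ _ (\int[mu]_p ((gamma ^+ n.-1 *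
     expR (gamma * ruf_outer tau kappa))%:E * (`|f p| ^+ n)%:E))%E).
    apply: (@le_trans _ _ (\int[mu]_(p in ~` E) ((gamma ^+ n.-1 *
     expR (gamma * ruf_outer tau kappa))%:E * (`|f p| ^+ n)%:E))%E).
      apply: ge0_le_integral_any => p Ep; first exact: phi0.
      by rewrite -EFinM lee_fin f_out.
    apply: ge0_subset_integral => //.
    + by apply: measurable_funeM; exact: measurable_fnorm.
    + move=> p _; rewrite -EFinM lee_fin mulr_ge0 ?exprn_ge0//.
      by rewrite mulr_ge0 ?exprn_ge0 ?MTconst_ge0 ?expR_ge0.
  rewrite ge0_integralZl_EFin//; last first.
    by rewrite mulr_ge0 ?exprn_ge0 ?MTconst_ge0 ?expR_ge0.
  rewrite [leRHS]EFinM lee_wpmul2l ?lee_fin ?mulr_ge0 ?exprn_ge0 ?MTconst_ge0 ?expR_ge0//.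
  apply: le_trans fs _; rewrite lee_fin -[leRHS]mul1r ler_pdivlMr//.
  by rewrite mulrC.
Qed.

End one_function.
End core.

(** * Passage to the limit *)

Lemma expe_le_EFin (R : realType) (x : \bar R) (r : R) (k : nat) :
  (0 <= x)%E -> (x <= r%:E)%E -> (x ^+ k <= (r ^+ k)%:E)%E.
Proof.
case: x => [x| |]//; rewrite !lee_fin -EFin_expe lee_fin => x0 xr.
by rewrite lerXn2r ?nnegrE// (le_trans x0).
Qed.

Section ae_limit.
Context d (T : measurableType d) (R : realType) (mu : {measure set T -> \bar R}).

Lemma summable_cvg0 (x : nat -> R) : (forall j, 0 <= x j) ->
  (\sum_(j <oo) (x j)%:E < +oo)%E -> x @ \oo --> 0.
Proof.
move=> x0 xoo; apply: cvg_series_cvg_0; apply: nondecreasing_is_cvgn.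
  by apply/nondecreasing_seqP => N; rewrite seriesSr lerDl.
exists (fine (\sum_(j <oo) (x j)%:E)%E) => _ [N _ <-].
have s0 : (0 <= \sum_(j <oo) (x j)%:E)%E by apply: nneseries_ge0 => j _ _; rewrite lee_fin.
rewrite -lee_fin fineK ?ge0_fin_numE// /series/= -sumEFin.
by apply: nneseries_lim_ge => j _ _; rewrite lee_fin.
Qed.

(** The errors |f j - u|^k have integrals with a finite sum, so their pointwise sum
has a finite integral and is finite almost everywhere. *)
Lemma ae_cvg_of_fast_Lk (f : nat -> T -> R) (u : T -> R) (k : nat) : (0 < k)%N ->
  (forall j, measurable_fun [set: T] (f j)) -> measurable_fun [set: T] u ->
  (forall j, \int[mu]_x (`|f j x - u x| ^+ k)%:E <= (1 / (2 ^ j.+1)%:R)%:E)%E ->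
  {ae mu, forall x, f ^~ x @ \oo --> u x}.
Proof.
move=> k0 mf meas_u fu.
pose e j x := `|f j x - u x| ^+ k.
have e0 j x : (0 <= (e j x)%:E)%E by rewrite lee_fin exprn_ge0.
have me j : measurable_fun [set: T] (fun x => (e j x)%:E).
  apply/measurable_EFinP/measurable_funX.
  by apply: (measurableT_comp (@normr_measurable _ _)); exact: measurable_funB.
have sum_lt : (\int[mu]_x \sum_(j <oo) (e j x)%:E < +oo)%E.
  rewrite integral_nneseries//.
  apply: le_lt_trans (ltry 1).
  apply: le_trans (epsilon_trick0 xpredT (@ler01 R)).
  by apply: lee_nneseries => [j _ _|j _]; [exact: integral_ge0|exact: fu].
have ms : measurable_fun [set: T] (fun x => \sum_(j <oo) (e j x)%:E)%E.
  exact: ge0_emeasurable_sum.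
have s0 x : (0 <= \sum_(j <oo) (e j x)%:E)%E by exact: nneseries_ge0.
have int_s : mu.-integrable [set: T] (fun x => \sum_(j <oo) (e j x)%:E)%E.
  apply/integrableP; split => //.
  by under eq_integral do rewrite gee0_abs//.
apply: filterS (integrable_ae measurableT int_s) => x /(_ I) xfin.
have ex0 : e ^~ x @ \oo --> 0.
  apply: summable_cvg0 => [j|]; first exact: exprn_ge0.
  by rewrite -ge0_fin_numE.
apply/cvgrPdistC_lt => eps eps0.
have epsk : 0 < eps ^+ k by exact: exprn_gt0.
have /cvgr0Pnorm_lt/(_ _ epsk) := ex0; apply: filterS => j /=.
rewrite ger0_norm ?exprn_ge0// /e => H.
by rewrite -(ltr_pXn2r k0) ?nnegrE ?(ltW eps0).
Qed.

Lemma fatou_continuous (v : nat -> T -> R) (u : T -> R) (Phi : R -> R) (C : R) :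
  continuous Phi -> (forall t, 0 <= Phi t) ->
  (forall j, measurable_fun [set: T] (v j)) -> measurable_fun [set: T] u ->
  {ae mu, forall x, v ^~ x @ \oo --> u x} ->
  (forall j, \int[mu]_x (Phi (v j x))%:E <= C%:E)%E ->
  (\int[mu]_x (Phi (u x))%:E <= C%:E)%E.
Proof.
move=> Pc P0 mv meas_u vu vC.
have mP (w : T -> R) : measurable_fun [set: T] w ->
    measurable_fun [set: T] (fun x => (Phi (w x))%:E).
  move=> mw; apply/measurable_EFinP; apply: measurableT_comp mw.
  exact: continuous_measurable_fun.
have P0E (w : T -> R) x : (0 <= (Phi (w x))%:E)%E by rewrite lee_fin.
pose F j x := (Phi (v j x))%:E.
have mF j : measurable_fun [set: T] (F j) by exact: mP.
have F0 j x : (0 <= F j x)%E by exact: P0E.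
have einf0 (a : nat -> \bar R) : (forall j, (0 <= a j)%E) -> (0 <= limn_einf a)%E.
  move=> a0; rewrite limn_einf_lim; apply: lime_ge; first exact: is_cvg_einfs.
  by apply: nearW => j; apply: le_ereal_inf_tmp => _ [i _ <-].
apply: (@le_trans _ _ (\int[mu]_x limn_einf (F ^~ x))%E).
  apply: ae_ge0_le_integral => //; first exact: mP.
  - by move=> x _; apply: einf0 => j.
  - rewrite /limn_einf; apply: measurableT_comp => //.
    by apply: measurable_fun_limn_esup => j; exact: measurableT_comp.
  apply: filterS vu => x vx _.
  have L : F ^~ x @ \oo --> (Phi (u x))%:E.
    have L0 : (fun j => Phi (v j x)) @ \oo --> Phi (u x).
      by apply: (@continuous_cvg _ _ _ _ _ _ Phi); [exact: Pc|exact: vx].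
    by apply: cvg_EFin; [exact: nearW|exact: L0].
  by rewrite (cvg_limn_einf_sup L).1.
apply: le_trans (fatou mu measurableT mF (fun j x _ => F0 j x)) _.
rewrite limn_einf_lim; apply: lime_le; first exact: is_cvg_einfs.
apply: nearW => j; apply: le_trans (vC j).
by apply: ereal_inf_lbound; exists j => //=.
Qed.
End ae_limit.

Lemma continuous_norm_powR (R : realType) (r : R) : 1 <= r ->
  continuous (fun t : R => `|t| `^ r).
Proof.
move=> r1 t; have [->|t0] := eqVneq t 0.
  rewrite /continuous_at normr0 powR0 ?gt_eqF ?(lt_le_trans ltr01)//.
  have near_norm_le (e : R) : 0 < e -> \forall s \near (0 : R), `|s| <= e.
    move=> e0; have /cvgr0Pnorm_le := @cvg_id _ (nbhs (0 : R)).
    exact.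
  apply/cvgrPdistC_le => e e0; near=> s.
  rewrite subr0 ger0_norm ?powR_ge0//.
  have [->|s0] := eqVneq s 0.
    by rewrite normr0 powR0 ?gt_eqF ?(lt_le_trans ltr01)// ltW.
  have s1 : `|s| <= 1 by near: s; exact: near_norm_le.
  apply: le_trans (ge1r_powR _ r1) _; first by rewrite normr_gt0 s0.
  by near: s; exact: near_norm_le.
apply: (@continuous_comp _ _ _ (fun s : R => `|s|) (fun s : R => s `^ r)).
  exact: norm_continuous.
apply: differentiable_continuous; apply/derivable1_diffP.
by apply: derivable_powR; rewrite in_itv/= andbT normr_gt0.
Unshelve. all: by end_near. Qed.

(** * Approximation by admissible test functions *)

Section approximation.
Context (R : realType) (n : nat) (hn : (2 <= n)%N) (M : ptopologicalType)
        (S : smooth_manifold R n M) (g : riemannian_metric S)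
        (mu : {measure set (borelType M) -> \bar R}).
Local Notation B := (borelType M).

Let n0 : (0 < n)%N. Proof. exact: ltnW. Qed.

Let n1 : 1 <= n%:R :> R. Proof. by rewrite ler1n. Qed.

Lemma fun_norm_le (f u : M -> R) :
  measurable_fun [set: B] (f : B -> R) -> measurable_fun [set: B] (u : B -> R) ->
  (fun_norm n mu f <= fun_norm n mu u + fun_norm n mu (fun p => f p - u p)%R)%E.
Proof.
move=> mf meas_u.
have E : fun_norm n mu f =
    Lnorm mu n%:R%:E (EFin \o ((u : B -> R) \+ (fun p => f p - u p))%R).
  by congr Lnorm; apply/funext => p /=; rewrite addrC subrK.
by rewrite E; apply: minkowski_EFin => //; exact: measurable_funB.
Qed.

Lemma field_norm_le (X Y : M -> 'rV[R]_n) :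
  measurable_field S X -> measurable_field S Y ->
  (field_norm g mu Y <= field_norm g mu X + field_norm g mu (fun p => Y p - X p)%R)%E.
Proof.
move=> mX mY.
have mgX : measurable_fun [set: B] (fun p : B => gnorm g p (X p)).
  exact: measurable_gnorm.
have mgD : measurable_fun [set: B] (fun p : B => gnorm g p (Y p - X p)).
  exact: (measurable_gnorm g (measurable_fieldB mY mX)).
apply: le_trans (minkowski_EFin mu mgX mgD n1).
apply: le_Lnorm => // p /=.
rewrite !ger0_norm ?addr_ge0 ?gnorm_ge0//.
by apply: le_trans (gnormD _ _ _ _); rewrite addrC subrK.
Qed.

(** At delta = 0 the left-hand side is at most theta^n < 1, and it is continuous in
delta. *)
Lemma error_margin (theta kappa a b eps : R) : 0 < theta < 1 -> 0 < kappa ->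
  a ^+ n + kappa * b ^+ n <= 1 -> 0 < eps ->
  exists delta : R, [/\ 0 < delta, delta ^+ n <= eps &
    theta ^+ n * ((a + delta) ^+ n + kappa * (b + delta) ^+ n) <= 1].
Proof.
move=> /andP[t0 t1] k0 ab e0.
pose P (x : R) := theta ^+ n * ((a + x) ^+ n + kappa * (b + x) ^+ n).
have shiftc (c : R) : (fun x : R => (c + x) ^+ n) @ (0 : R) --> c ^+ n.
  have H : (fun x : R => c + x) @ (0 : R) --> c.
    by rewrite -[X in _ --> X]addr0; apply: cvgD; [exact: cvg_cst|exact: cvg_id].
  exact: (cvg_comp _ _ H (@exprn_continuous _ n c)).
have Pc : P @ (0 : R) --> theta ^+ n * (a ^+ n + kappa * b ^+ n).
  apply: cvgM; first exact: cvg_cst.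
  by apply: cvgD; [exact: shiftc|apply: cvgM; [exact: cvg_cst|exact: shiftc]].
have P1 : theta ^+ n * (a ^+ n + kappa * b ^+ n) < 1.
  have tn1 : theta ^+ n < 1 by rewrite exprn_ilt1 ?(ltW t0)// -lt0n.
  have tn0 : 0 < theta ^+ n by exact: exprn_gt0.
  by apply: le_lt_trans tn1; rewrite ler_piMr// ltW.
have dn : (fun x : R => (0 + x) ^+ n) @ (0 : R) --> 0.
  by have := shiftc 0; rewrite expr0n gtn_eqF.
near (0 : R)^'+ => x; exists x; split => //.
- apply: ltW; rewrite -[x]add0r; near: x.
  by have /cvgr_lt := cvg_at_right_filter dn; exact.
- apply: ltW; near: x.
  by have /cvgr_lt := cvg_at_right_filter Pc; exact.
Unshelve. all: by end_near. Qed.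

(** Test functions close to u may slightly violate the constraint; scaling by
theta < 1 leaves room for the error.  The bound s on the norm is positive even if
u = 0, which lets [ruf_one] divide by it. *)
Lemma W0_approx (u : M -> R) (X : M -> 'rV[R]_n) (theta kappa eps : R) :
  0 < theta < 1 -> 0 < kappa -> 0 < eps -> W0 g mu u X ->
  (field_norm g mu X ^+ n + kappa%:E * fun_norm n mu u ^+ n <= 1)%E ->
  exists (f : M -> R) (s : R), [/\ test_function S f, 0 < s,
    (\int[mu]_p (`|f p - u p| ^+ n)%:E <= eps%:E)%E,
    (\int[mu]_p (`|theta * f p| ^+ n)%:E <= s%:E)%E &
    (field_norm g mu (gradient g (fun p => theta * f p)%R) ^+ n + (kappa * s)%:E <= 1)%E].
Proof.
move=> t01 k0 e0 [meas_u mX [f [tf fu fX]]] Xu1.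
have /andP[t0 t1] := t01.
set a := field_norm g mu X in Xu1 *; set b := fun_norm n mu u in Xu1 *.
have a0 : (0 <= a)%E := field_norm_ge0 g mu X.
have b0 : (0 <= b)%E := fun_norm_ge0 n mu u.
have an0 : (0 <= a ^+ n)%E by exact: expe_ge0.
have bn0 : (0 <= b ^+ n)%E by exact: expe_ge0.
have yn : (+oo ^+ n = +oo :> \bar R)%E.
  by case: (n) n0 => // k _; elim: k => // k IH; rewrite expeS IH mulyy.
have afin : a \is a fin_num.
  rewrite ge0_fin_numE// ltey; apply/eqP => ay.
  by move: Xu1; rewrite ay yn addye// gt_eqF// (lt_le_trans (ltNyr 0))// mule_ge0// lee_fin ltW.
have bfin : b \is a fin_num.
  rewrite ge0_fin_numE// ltey; apply/eqP => by_.
  move: Xu1; rewrite by_ yn gt0_muley ?lte_fin// addey// gt_eqF//.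
  exact: lt_le_trans (ltNyr 0) an0.
have ab1 : fine a ^+ n + kappa * fine b ^+ n <= 1.
  by rewrite -lee_fin EFinD EFinM !EFin_expe !fineK.
have [delta [d0 dn dab]] := error_margin t01 k0 ab1 e0.
have near_le (x : nat -> \bar R) : x @ \oo --> 0%E -> \forall k \near \oo, (x k <= delta%:E)%E.
  move=> x0; have d0E : (0 < delta%:E)%E by rewrite lte_fin.
  have : \forall k \near \oo, (x k < delta%:E)%E := x0 _ (open_ereal_lt' d0E).
  by apply: filterS => k /ltW.
near \oo => k.
have fuk : (fun_norm n mu (fun p => f k p - u p)%R <= delta%:E)%E.
  by near: k; exact: near_le.
have fXk : (field_norm g mu (fun p => gradient g (f k) p - X p)%R <= delta%:E)%E.
  by near: k; exact: near_le.
have [sf cf] := tf k.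
have mf : measurable_fun [set: B] (f k : B -> R) := measurable_smooth_fun sf.
have fk_le : (fun_norm n mu (f k) <= (fine b + delta)%:E)%E.
  by apply: le_trans (fun_norm_le mf meas_u) _; rewrite EFinD fineK// leeD2l.
have gk_le : (field_norm g mu (gradient g (f k)) <= (fine a + delta)%:E)%E.
  apply: le_trans (field_norm_le mX (measurable_gradient g sf)) _.
  by rewrite EFinD fineK// leeD2l.
have tn0 : 0 <= theta ^+ n by rewrite exprn_ge0 ?ltW.
exists (f k), (theta ^+ n * (fine b + delta) ^+ n); split => //.
- rewrite mulr_gt0 ?exprn_gt0// ltr_wpDl// fine_ge0//.
- rewrite -(fun_normX hn mu (fun p => f k p - u p)).
  apply: le_trans (expe_le_EFin _ (fun_norm_ge0 _ _ _) fuk) _.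
  by rewrite lee_fin.
- under eq_integral do rewrite normrM exprMn (ger0_norm (ltW t0)) EFinM.
  rewrite ge0_integralZl_EFin//; last first.
    apply/measurable_EFinP/measurable_funX.
    exact: (measurableT_comp (@normr_measurable _ _) mf).
  rewrite -(fun_normX hn mu (f k)) EFinM lee_wpmul2l ?lee_fin//.
  exact: expe_le_EFin (fun_norm_ge0 _ _ _) fk_le.
- have gE p : gradient g (fun p => theta * f k p) p = theta *: gradient g (f k) p.
    exact: (gradient_comp g sf (is_derive_mul theta (f k p))).
  rewrite (field_normX hn).
  under eq_integral do rewrite gE gnormZ exprMn (ger0_norm (ltW t0)) EFinM.
  rewrite ge0_integralZl_EFin//; last 2 first.
  + by move=> p _; rewrite lee_fin exprn_ge0 ?gnorm_ge0.
  + apply/measurable_EFinP/measurable_funX.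
    exact: measurable_gnorm (measurable_gradient g sf).
  rewrite -(field_normX hn).
  apply: (@le_trans _ _ ((theta ^+ n * (fine a + delta) ^+ n)%:E +
     (kappa * (theta ^+ n * (fine b + delta) ^+ n))%:E)%E).
    rewrite leeD2r// EFinM lee_wpmul2l ?lee_fin//.
    exact: expe_le_EFin (field_norm_ge0 _ _ _) gk_le.
  by rewrite -EFinD lee_fin (mulrCA kappa) -mulrDr.
Unshelve. all: by end_near. Qed.

End approximation.

Theorem theorem4 (R : realType) (n : nat) (hn : (2 <= n)%N)
    (M : ptopologicalType) (S : smooth_manifold R n M)
    (hconn : connected [set: M])
    (g : riemannian_metric S) (hcomplete : complete_metric g)
    (mu : {measure set (borelType M) -> \bar R})
    (hmu : is_riemannian_measure g mu) :
  local_MoserTrudinger g mu -> Ruf_MoserTrudinger g mu.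
Proof.
move=> [tau [C0 [tau0 C00 LMT]]] kappa kappa0.
exists (ruf_const n tau C0 kappa).
  apply: ltr_pwDl; first by rewrite mulr_gt0 ?expR_gt0.
  by rewrite !mulr_ge0 ?exprn_ge0 ?MTconst_ge0 ?expR_ge0 ?invr_ge0 ?(ltW kappa0).
move=> u X uX Xu1; have [meas_u _ _] := uX.
pose theta (j : nat) : R := 1 - j.+2%:R^-1.
have theta01 j : 0 < theta j < 1.
  rewrite /theta subr_gt0 invf_lt1 ?ltr0n// ltr1n/= ltrBlDr ltrDl invr_gt0 ltr0n.
  by [].
(* The errors 2^(-j-1) have a finite sum. *)
have eps0 j : 0 < 1 / (2 ^ j.+1)%:R :> R by rewrite divr_gt0// ltr0n expn_gt0.
have /choice[f fP] j := W0_approx hn (theta01 j) kappa0 (eps0 j) uX Xu1.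
have sf j : smooth_fun S (f j) by have [s [[]]] := fP j.
have mf j : measurable_fun [set: borelType M] (f j : borelType M -> R).
  exact: measurable_smooth_fun (sf j).
pose Phi (t : R) := exp_trunc (n - 2) (MTconst R n * `|t| `^ conj_exp R n).
apply: (@fatou_continuous _ (borelType M) R mu
  (fun j (p : borelType M) => theta j * f j p) u Phi) => //.
- move=> t; rewrite /Phi.
  apply: (@continuous_comp _ _ _ (fun t : R => MTconst R n * `|t| `^ conj_exp R n)).
    apply: (@continuous_comp _ _ _ (fun t : R => `|t| `^ conj_exp R n)).
      exact: (continuous_norm_powR (conj_exp_ge1 R hn)).
    exact: mulrl_continuous.
  exact: exp_trunc_continuous.
- by move=> t; rewrite exp_trunc_ge0// mulr_ge0 ?MTconst_ge0 ?powR_ge0.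
- by move=> j; exact: measurable_funM.
- have fu j : (\int[mu]_p (`|f j p - u p| ^+ n)%:E <= (1 / (2 ^ j.+1)%:R)%:E)%E.
    by have [s []] := fP j.
  have := ae_cvg_of_fast_Lk (ltnW hn) mf meas_u fu.
  apply: filterS => p fp; rewrite -[u p]mul1r; apply: cvgM fp.
  rewrite -[X in _ --> X]subr0; apply: cvgB; first exact: cvg_cst.
  have := @cvg_harmonic R; rewrite -cvg_shiftS; exact.
- move=> j; have [s [tf s0 _ fs fks]] := fP j.
  have tv : test_function S (fun p => theta j * f j p).
    exact: (test_function_comp (smooth_real_mul (theta j)) (mulr0 _) tf).
  exact: (ruf_one hn hconn tv tau0 kappa0 s0 fs fks LMT).
Qed.
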